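(* Let $\mathcal H$ be a real Hilbert space and $\Phi=f+g$, where $f:\mathcal H\to\mathbb R$ is continuously Fréchet differentiable and $\mu$-strongly convex with $\mu>0$, $\nabla f$ is $L$-Lipschitz continuous ($L>0$, $\mu<L$), $g:\mathcal H\to(-\infty,+\infty]$ is proper, lower semicontinuous and convex, and $\operatorname{argmin}\Phi\neq\varnothing$. Let $0<s\le1/L$, $x^*\in\operatorname{argmin}\Phi$, $\Phi^*=\Phi(x^* )$. Let $S:[0,+\infty)\to[0,1)$ be continuously differentiable, nondecreasing and concave with $S(0)=0$. Suppose that $0<2S'(r)+S(r)^2\le1$ for all $r\ge0$, that $S'(0)=\kappa$ for some $\kappa\in(0,1/2]$, that $S(r)\to1$ and $S'(r)\to0$ as $r\to+\infty$, and that $$\xi:=\int_0^{+\infty}\bigl(1-S(r)\bigr)\,dr<+\infty .$$ Define $$\theta_{k+1}:=\frac1{\sqrt\mu}\left[\sqrt{s\mu}+\bigl(1-\sqrt{s\mu}\bigr)S\bigl(k\sqrt{s\mu}\bigr)\right],\qquad k\ge0 .$$ Then the following hold. (i) For every $k\ge1$, $\theta_k\ge\sqrt s$, $\mu\theta_k^2\le1$, and $$\bigl(1-\sqrt s\,\mu\theta_{k+1}\bigr)\theta_k^2\ge\left(1-\frac{\sqrt s}{\theta_{k+1}}\right)\theta_{k+1}^2 .$$ Moreover, $\{\theta_k\}$ is nondecreasing and $\theta_k\to\frac1{\sqrt\mu}$ as $k\to+\infty$. (ii) The inertial coefficient $$\beta_k=\frac{(\theta_k-\sqrt s)\bigl(1-\mu\sqrt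 s\,\theta_{k+1}\bigr)}{(1-s\mu)\theta_{k+1}}$$ satisfies $$\beta_k\to\frac{\kappa(k-1)}{1+\kappa k}\ \text{ as }\mu\downarrow0\text{ for each fixed }k\ge1,\qquad\beta_k\to\frac{1-\sqrt{s\mu}}{1+\sqrt{s\mu}}\ \text{ as }k\to+\infty\text{ for each fixed }\mu>0.$$ In particular, if $\kappa=1/(\gamma-1)$ for some $\gamma\ge3$, then $\beta_k\to\frac{k-1}{k+\gamma-1}$ as $\mu\downarrow0$ for every fixed $k\ge1$. (iii) The iterates generated by either the one-sequence scheme or the two-sequence scheme (both defined in the context) satisfy $$\Phi(x_k)-\Phi^*\le\frac{\mathcal E_1}{s}\min\left\{\frac1{C_{s,\mu}(k-1)^2},\ e^{\sqrt{s\mu}+\xi}\bigl(1-\sqrt{s\mu}\bigr)^k\right\},\qquad k>1,$$ where $$C_{s,\mu}:=\min\left\{\bigl(1-\sqrt{s\mu}\bigr)^2S(1)^2,\ \frac{\bigl(1-\sqrt{s\mu}\bigr)^4S(1)^4}{4}\,e^{2-(1-\sqrt{s\mu})S(1)}\right\}.$$ Consequently, $\Phi(x_k)-\Phi^*=\mathcal O\left(\min\left\{\frac1{k^2},\bigl(1-\sqrt{s\mu}\bigr)^k\right\}\right)$.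
   Context: Strong convexity: $f(y)\ge f(x)+\langle\nabla f(x),y-x\rangle+\frac\mu2\|y-x\|^2$ for all $x,y\in\mathcal H$. Proximal map: $\operatorname{prox}_{\lambda g}(u)=\operatorname{argmin}_{v\in\mathcal H}\{g(v)+\frac1{2\lambda}\|v-u\|^2\}$, $\lambda>0$. Both schemes are initialized with $x_0=x_1=z_1\in\operatorname{dom}g$ and use, for $k\ge1$, $y_k=x_k+\beta_k(x_k-x_{k-1})$ with $\beta_k$ as in (ii). One-sequence scheme: $x_{k+1}=\operatorname{prox}_{sg}\bigl(y_k-s\nabla f(y_k)\bigr)$; the auxiliary sequence is defined by $z_{k+1}=x_k+\frac{\theta_{k+1}}{\sqrt s}(x_{k+1}-x_k)$ for $k\ge1$. Two-sequence scheme: $$z_{k+1}=\operatorname{prox}_{\sqrt s\,\theta_{k+1}g}\Bigl(z_k-\mu\sqrt s\,\theta_{k+1}(z_k-y_k)-\sqrt s\,\theta_{k+1}\nabla f(y_k)\Bigr),\qquad x_{k+1}=\left(1-\frac{\sqrt s}{\theta_{k+1}}\right)x_k+\frac{\sqrt s}{\theta_{k+1}}z_{k+1}.$$ An equivalent form of the two-sequence scheme replaces the formulas for $y_k$ and $z_{k+1}$ by $$y_k=\frac{\theta_{k+1}-\sqrt s}{\theta_{k+1}(1-s\mu)}x_k+\frac{\sqrt s\,(1-\mu\sqrt s\,\theta_{k+1})}{\theta_{k+1}(1-s\mu)}z_k,\qquad z_{k+1}=\operatorname{prox}_{\sqrt s\,\theta_{k+1}g}\Bigl(\tfrac{\theta_{k+1}}{\sqrt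 s}y_k-\tfrac{\theta_{k+1}-\sqrt s}{\sqrt s}x_k-\sqrt s\,\theta_{k+1}\nabla f(y_k)\Bigr).$$ The constant $\mathcal E_1$ is $$\mathcal E_1=A_1\bigl(\Phi(x_1)-\Phi^*\bigr)+\frac{M_1}{2}\|z_1-x^*\|^2,\qquad A_1=\frac{\theta_1^2}{1-\sqrt s\,\mu\theta_1},\quad M_1=\frac1{1-\sqrt s\,\mu\theta_1}.$$ In the limit $\mu\downarrow0$ in (ii), $s$ and $S$ are fixed, and $\theta_k$, $\beta_k$ are regarded as functions of $\mu$ through their explicit formulas. *)

(* Defs.v *)
From HB Require Import structures.
From mathcomp Require Import all_boot all_order all_algebra sesquilinear.
From mathcomp Require Import all_classical all_reals all_analysis.

Set Implicit Arguments.
Unset Strict Implicit.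
Unset Printing Implicit Defensive.

Import Order.TTheory GRing.Theory Num.Theory.
Import numFieldNormedType.Exports.

Local Open Scope classical_set_scope.
Local Open Scope ring_scope.

(* A real Hilbert space is a complete normed module H together with a
   (symmetric, positive definite) bilinear form ip inducing its norm. *)
Definition induces_norm (R : realType) (H : completeNormedModType R)
    (ip : {dot H for (@idfun R)}) :=
  forall v : H, `|v| ^+ 2 = ip v v.

Section convex_analysis.
Context {R : realType} {H : completeNormedModType R}.
Implicit Types (ip : {dot H for (@idfun R)}) (f : H -> R) (g : H -> \bar R).

Definition is_gradient ip f (gradf : H -> H) :=
  forall x, differentiable f x /\ forall h, 'd f x h = ip (gradf x) h.

Definition strongly_convex ip (mu : R) f (gradf : H -> H) :=
  forall x y,
    f x + ip (gradf x) (y - x) + mu / 2 * `|y - x| ^+ 2 <= f y.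

Local Open Scope ereal_scope.

Definition edom g : set H := [set x | g x < +oo].

Definition proper_fun g := (forall x, g x != -oo) /\ edom g !=set0.

Definition econvex g := forall (x y : H) (t : R), (0 <= t <= 1)%R ->
  g (t *: x + (1 - t) *: y)%R <= t%:E * g x + (1 - t)%:E * g y.

Definition argmin g : set H := [set x | forall y, g x <= g y].

(* For g proper, lower semicontinuous and convex and lambda > 0, the argmin
   below is a singleton, so that [get] returns its unique element. *)
Definition prox (lambda : R) g (u : H) : H :=
  get (argmin (fun v => g v + ((2 * lambda)^-1 * `|v - u| ^+ 2)%:E)).

End convex_analysis.

(* Derivative relative to A: one-sided at an endpoint of an interval A,
   the usual one in its interior. *)
Definition derivative_within (R : realType) (A : set R) (F dF : R -> R) :=
  forall r, A r ->
    (F x - F r) / (x - r) @[x --> within A r^'] --> dF r.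

Section parameters.
Context {R : realType}.
Variables (S : R -> R) (s mu : R).

(* Only used for k >= 1, where k.-1 is the honest predecessor. *)
Definition theta (k : nat) : R :=
  (Num.sqrt mu)^-1 *
  (Num.sqrt (s * mu) +
   (1 - Num.sqrt (s * mu)) * S (k.-1%:R * Num.sqrt (s * mu))).

Definition beta (k : nat) : R :=
  (theta k - Num.sqrt s) * (1 - mu * Num.sqrt s * theta k.+1) /
  ((1 - s * mu) * theta k.+1).

Definition Csmu : R :=
  let c := (1 - Num.sqrt (s * mu)) * S 1 in
  Num.min (c ^+ 2) (c ^+ 4 / 4 * expR (2 - c)).

End parameters.

Section schemes.
Context {R : realType} {H : completeNormedModType R}.
Variables (gradf : H -> H) (g : H -> \bar R) (S : R -> R) (s mu : R).

Definition extrapolation (x : nat -> H) (k : nat) : H :=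
  x k + beta S s mu k *: (x k - x k.-1).

Definition scheme_init (x z : nat -> H) :=
  [/\ x 0%N = x 1%N, x 1%N = z 1%N & edom g (x 1%N)].

Definition one_sequence_scheme (x z : nat -> H) :=
  scheme_init x z /\
  forall k : nat, (1 <= k)%N ->
    let y := extrapolation x k in
    x k.+1 = prox s g (y - s *: gradf y) /\
    z k.+1 = x k + (theta S s mu k.+1 / Num.sqrt s) *: (x k.+1 - x k).

Definition two_sequence_scheme (x z : nat -> H) :=
  scheme_init x z /\
  forall k : nat, (1 <= k)%N ->
    let y := extrapolation x k in
    let lambda := Num.sqrt s * theta S s mu k.+1 in
    let tau := Num.sqrt s / theta S s mu k.+1 in
    z k.+1 =
      prox lambda g
        (z k - (mu * lambda) *: (z k - y) - lambda *: gradf y) /\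
    x k.+1 = (1 - tau) *: x k + tau *: z k.+1.

Local Open Scope ereal_scope.

Definition energy1 (Phi : H -> \bar R) (xstar x1 z1 : H) : \bar R :=
  let t1 := theta S s mu 1 in
  let A1 := (t1 ^+ 2 / (1 - Num.sqrt s * mu * t1))%R in
  let M1 := ((1 - Num.sqrt s * mu * t1)^-1)%R in
  A1%:E * (Phi x1 - Phi xstar) + (M1 / 2 * `|z1 - xstar| ^+ 2)%:E.

End schemes.

(* Main.v *)
Require Import Defs.
From mathcomp Require Import all_boot all_order all_algebra sesquilinear.
From mathcomp Require Import all_classical all_reals all_analysis.
From mathcomp Require Import measurable_realfun ring lra.

Set Implicit Arguments.
Unset Strict Implicit.
Unset Printing Implicit Defensive.

Import Order.TTheory GRing.Theory Num.Theory.
Import numFieldNormedType.Exports.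

Local Open Scope classical_set_scope.
Local Open Scope ring_scope.

(** Put [h = sqrt (s mu)] and [level k = sqrt mu * theta k], so that
    [level k = h + (1 - h) S((k - 1) h)] lies between [h] and [1].

    The growth inequality of (i) reads
    [level (k+1)^2 - level k^2 <= h level (k+1) (1 - level k^2)].  It is a
    discrete form of [2 S' + S^2 <= 1]: by concavity the increment of [S] over
    a step is at most [h S'], taken at the left endpoint, hence at most
    [h (1 - S^2) / 2].  The limits of (ii) follow by writing [theta] and [beta]
    in terms of [S(j h) / h], which tends to [kappa j] as [mu] vanishes.

    For (iii) let [tau = sqrt s / theta (k+1)] and
    [lambda = sqrt s * theta (k+1)], so that [tau lambda = s].  In both schemes
    [x (k+1) = (1 - tau) x k + tau z (k+1)], and the formula for [beta] says
    exactly that [y = (1 - tau) x k + tau w] for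
    [w = z k - mu lambda (z k - y)] (lemma [extrapolation_anchor]).  The descent
    lemma, strong convexity and the variational inequality of the proximal
    point then give one and the same estimate [step_decrease] for the two
    schemes: [w] is a convex combination of [z k] and [y], and the strong
    convexity term [tau mu / 2 |xstar - y|^2] pays exactly for the share of [y]
    when [|w - xstar|^2] is bounded by convexity.  With the growth inequality,
    the energy [theta k^2 (Phi (x k) - Phi xstar) + |z k - xstar|^2 / 2] is
    multiplied by at most [1 - h level (k+1)] at each step, and it remains to
    bound the product [decay k] of these factors divided by [theta k^2].

    Exponential bound: [1 - h level j = (1 - h) (1 + h (1 - S((j - 1) h)))],
    and the sum of the [h (1 - S((j - 1) h))] is at most [h + xi], being the
    first term [h] plus a lower Riemann sum.  Polynomial bound: with
    [c = (1 - h) S 1], as long as [(k - 1) h <= 1] concavity gives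
    [level k >= c (k - 1) h]; afterwards [level k >= c], the product is at most
    [exp (- c ((k - 1) h - 1))], and [u exp (1 - u) <= 1] at
    [u = c (k - 1) h / 2] absorbs the factor [(k - 1)^2].

    The proximal map is an [argmin] chosen by [get], so minimizers must be
    shown to exist ([prox_argmin]).  Optimality of [xstar] yields an affine
    minorant of [g], whence the proximal objective is bounded below; its
    minimizing sequences are Cauchy by the parallelogram identity, and lower
    semicontinuity passes to the limit. *)

(** * Elementary real inequalities *)

Section real_inequalities.
Context {R : realType}.

(** A right derivative at a minimum is nonnegative: the quadratic term is
    negligible as [t] tends to [0]. *)
Lemma linear_coef_ge0 (a b : R) :
  (forall t, 0 < t <= 1 -> 0 <= t * a + t ^+ 2 * b) -> 0 <= a.
Proof.
move=> ab; rewrite leNgt; apply/negP => a0.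
pose t := - a / (2 * (`|b| + - a)).
have den : 0 < 2 * (`|b| + - a) by rewrite mulr_gt0// ltr_wpDl// oppr_gt0.
have tE : t * (2 * (`|b| - a)) = - a by rewrite /t divfK// gt_eqF.
have t0 : 0 < t by rewrite divr_gt0// oppr_gt0.
have t1 : t <= 1 by rewrite ler_pdivrMr// mul1r; have := normr_ge0 b; lra.
have := ab t; rewrite t0 t1 => /(_ isT).
rewrite expr2 -mulrA -mulrDr pmulr_rge0// => h.
have : t * b <= t * `|b| by rewrite ler_wpM2l ?ler_norm// ltW.
have : 0 <= t * `|b| by rewrite mulr_ge0 ?(ltW t0).
nra.
Qed.

Lemma mul_expR1B_le1 (u : R) : 0 <= u -> u * expR (1 - u) <= 1.
Proof.
move=> u0; rewrite -(opprB u 1) expRN ler_pdivrMr ?expR_gt0// mul1r.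
by have := expR_ge1Dx (u - 1); rewrite addrC subrK.
Qed.

End real_inequalities.

(** * The concave profile *)

Section profile.
Context {R : realType}.
Variables (S dS : R -> R).
Hypothesis S_range : forall r : R, 0 <= r -> 0 <= S r < 1.
Hypothesis S_der : derivative_within `[0, +oo[ S dS.
Hypothesis S_mono : {in `[0, +oo[ &, {homo S : r t / r <= t}}.
Hypothesis S_conc : convex_function (`[0, +oo[ : set R) (fun r => - S r).
Hypothesis S0 : S 0 = 0.

Lemma concave_chord (l r t : R) : 0 <= r -> 0 <= t -> 0 <= l <= 1 ->
  l * S r + (1 - l) * S t <= S (l * r + (1 - l) * t).
Proof.
move=> r0 t0 l01.
have := @S_conc (Itv01 (proj1 (andP l01)) (proj2 (andP l01))) r t.
rewrite !inE /= !in_itv /= !andbT => /(_ r0 t0) H.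
rewrite -lerN2; apply: le_trans H _.
have -> : - (l * S r + (1 - l) * S t) =
    l *: (- S r : R^o) + (1 - l) *: (- S t : R^o).
  by rewrite /GRing.scale/= !mulrN opprD.
by [].
Qed.

Lemma derivative_within_near (r e : R) : 0 <= r -> 0 < e ->
  exists2 d, 0 < d & forall x, 0 <= x -> x != r -> `|x - r| < d ->
    `|dS r - (S x - S r) / (x - r)| < e.
Proof.
move=> r0 e0.
have rin : [set` `[0, +oo[%R] r by rewrite /= in_itv/= r0.
have := S_der rin => /cvgrPdist_lt /(_ e e0); rewrite near_withinE.
move=> /nbhs_ballP[d /= d0 near_r].
exists d => // x x0 xr xd.
have := near_r x; apply => //=; first by rewrite /ball /= distrC.
by rewrite in_itv/= x0.
Qed.

(** The difference quotients of a concave function decrease, so a chord of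
    slope larger than [dS r] would keep all the quotients near [r] above it. *)
Lemma concave_below_tangent (r t : R) : 0 <= r -> 0 <= t ->
  S (r + t) - S r <= t * dS r.
Proof.
move=> r0; rewrite le_eqVlt => /orP[/eqP<-|t0].
  by rewrite addr0 subrr mul0r.
rewrite -ler_pdivrMl// mulrC leNgt; apply/negP => lt_q.
have [|d d0 near_r] := @derivative_within_near r ((S (r + t) - S r) / t - dS r) r0.
  by rewrite subr_gt0.
pose u := Num.min t (d / 2).
have u0 : 0 < u by rewrite lt_min t0 divr_gt0.
have ut : u <= t by rewrite ge_min lexx.
have ud : u < d.
  by rewrite gt_min [d / 2 < d]ltr_pdivrMr// ltr_pMr// ltr1n orbT.
have u1 : r + u - r = u by ring.
have /= := near_r (r + u) (addr_ge0 r0 (ltW u0)).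
rewrite -subr_eq0 u1 gt_eqF// gtr0_norm// => /(_ isT ud).
have l01 : 0 <= 1 - u / t <= 1.
  rewrite subr_ge0 ler_pdivrMr// mul1r ut lerBlDr lerDl divr_ge0//; exact: ltW.
have := concave_chord r0 (addr_ge0 r0 (ltW t0)) l01.
have -> : (1 - u / t) * r + (1 - (1 - u / t)) * (r + t) = r + u.
  by field; rewrite gt_eqF.
move=> chord; rewrite ltr_norml => /andP[+ _].
rewrite opprB ltrD2l ltrN2 ltr_pdivrMr//.
have -> : (S (r + t) - S r) / t * u = (S (r + t) - S r) * (u / t).
  by field; rewrite gt_eqF.
by move/lt_le_trans => /(_ (S (r + u) - S r)); lra.
Qed.

Lemma S_ge0 r : 0 <= r -> 0 <= S r.
Proof. by case/S_range/andP. Qed.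

Lemma S_lt1 r : 0 <= r -> S r < 1.
Proof. by case/S_range/andP. Qed.

Lemma S_le r t : 0 <= r -> r <= t -> S r <= S t.
Proof.
by move=> r0 rt; apply: S_mono => //; rewrite in_itv/= ?r0 ?(le_trans r0 rt).
Qed.

Lemma concave_above_chord01 t : 0 <= t <= 1 -> t * S 1 <= S t.
Proof.
move=> t01; have := concave_chord ler01 (lexx 0) t01.
by rewrite S0 !mulr0 mulr1 !addr0.
Qed.

(** [S] starts with positive slope and does not decrease. *)
Lemma S1_gt0 : 0 < dS 0 -> 0 < S 1.
Proof.
move=> k0; have [d d0 near_zero] := derivative_within_near (lexx 0) k0.
pose u := Num.min 1 (d / 2).
have u0 : 0 < u by rewrite lt_min ltr01 divr_gt0.
have u1 : u <= 1 by rewrite ge_min lexx.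
have ud : u < d.
  by rewrite gt_min [d / 2 < d]ltr_pdivrMr// ltr_pMr// ltr1n orbT.
have := near_zero u (ltW u0); rewrite subr0 gtr0_norm// gt_eqF// => /(_ isT ud).
rewrite S0 subr0 => near_u; apply: lt_le_trans (S_le (ltW u0) u1).
rewrite -(pmulr_lgt0 (S u) (_ : 0 < u^-1)) ?invr_gt0//.
by move: near_u; rewrite ltr_norml; lra.
Qed.

End profile.

(** * Riemann sums of the defect of the profile *)

Section riemann_sum.
Context {R : realType}.
Variables (S : R -> R).
Hypothesis S_range : forall r : R, 0 <= r -> 0 <= S r < 1.
Hypothesis S_mono : {in `[0, +oo[ &, {homo S : r t / r <= t}}.

Lemma gap_measurable (A : set R) : measurable A -> A `<=` `[0, +oo[ ->
  measurable_fun A (EFin \o (fun r => 1 - S r)).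
Proof.
move=> mA A0; apply/measurable_EFinP.
apply: measurable_funB; first exact: measurable_cst.
(* Extended by a constant to the left of 0, the profile is monotone on the
   whole line. *)
apply: (@eq_measurable_fun _ _ _ _ A (fun r : R => S (Num.max 0 r))).
  move=> r; rewrite inE => /A0 /=; rewrite in_itv/= andbT => r0.
  by rewrite max_r.
apply: nondecreasing_measurable => // r t rt.
apply: (S_le S_mono); first by rewrite le_max lexx.
by rewrite ge_max le_max lexx/= le_max rt orbT.
Qed.

Lemma gap_ge0 r : 0 <= r -> 0 <= 1 - S r.
Proof. by move=> r0; rewrite subr_ge0 ltW// (S_lt1 S_range). Qed.

Lemma lower_sum_le_integral (h : R) (n : nat) : 0 < h ->
  ((\sum_(1 <= j < n.+1) h * (1 - S (j%:R * h)))%:E <=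
   \int[lebesgue_measure]_(r in `[0%R, (n%:R * h)%R[) (1 - S r)%:E)%E.
Proof.
move=> h0; elim: n => [|n IH].
  rewrite big_nil; apply: integral_ge0 => r /=.
  by rewrite in_itv/= lee_fin => /andP[r0 _]; exact: gap_ge0.
have nh0 : 0 <= n%:R * h by rewrite mulr_ge0// ltW.
have nS : n.+1%:R * h = n%:R * h + h by rewrite -natr1; ring.
have nh_le : n%:R * h <= n.+1%:R * h by rewrite nS lerDl ltW.
have split_itv : [set` `[0, n.+1%:R * h[%R] =
    [set` `[0, n%:R * h[%R] `|` [set` `[n%:R * h, n.+1%:R * h[%R].
  by rewrite -itv_bndbnd_setU// bnd_simp.
rewrite big_nat_recr//= EFinD split_itv ge0_integral_setU//=.
- apply: leeD => //.
  have -> : (h * (1 - S (n.+1%:R * h)))%:E =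
      (\int[lebesgue_measure]_(r in `[(n%:R * h)%R, (n.+1%:R * h)%R[)
        (1 - S (n.+1%:R * h))%:E)%E.
    rewrite integral_cst//= lebesgue_measure_itv/= lte_fin nS ltrDl h0.
    by rewrite -EFinD addrAC subrr add0r -EFinM mulrC.
  apply: ge0_le_integral => //.
  + by move=> r _; rewrite lee_fin gap_ge0// mulr_ge0// ltW.
  + apply: gap_measurable => // r /=; rewrite !in_itv/= andbT => /andP[nr _].
    exact: le_trans nr.
  + move=> r /=; rewrite in_itv/= lee_fin => /andP[nr rn].
    by rewrite lerD2l lerN2; apply: (S_le S_mono); [exact: le_trans nr|exact: ltW].
- rewrite -split_itv; apply: gap_measurable => // r /=.
  by rewrite !in_itv/= andbT => /andP[].
- move=> r []; rewrite in_itv/= lee_fin => /andP[r0 _]; apply: gap_ge0 => //.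
  exact: le_trans r0.
- apply/disj_setPS => r /= []; rewrite /=  !in_itv/= => /andP[_ rn] /andP[nr _].
  by move: (lt_le_trans rn nr); rewrite ltxx.
Qed.

Lemma lower_sum_le (h xi : R) (n : nat) : 0 < h ->
  (\int[lebesgue_measure]_(r in `[0%R, +oo[) (1 - S r)%:E = xi%:E)%E ->
  \sum_(1 <= j < n.+1) h * (1 - S (j%:R * h)) <= xi.
Proof.
move=> h0 hxi; rewrite -lee_fin -hxi.
apply: le_trans (lower_sum_le_integral n h0) _.
apply: ge0_subset_integral => //.
- by apply: gap_measurable.
- by move=> r /=; rewrite in_itv/= andbT lee_fin; exact: gap_ge0.
- by move=> r /=; rewrite !in_itv/= andbT => /andP[].
Qed.

End riemann_sum.

(** * Growth of theta and the accumulated contraction *)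

Section theta_bounds.
Context {R : realType}.
Variables (S dS : R -> R) (s mu : R).
Hypothesis S_range : forall r : R, 0 <= r -> 0 <= S r < 1.
Hypothesis S_der : derivative_within `[0, +oo[ S dS.
Hypothesis S_mono : {in `[0, +oo[ &, {homo S : r t / r <= t}}.
Hypothesis S_conc : convex_function (`[0, +oo[ : set R) (fun r => - S r).
Hypothesis S_riccati : forall r : R, 0 <= r -> 0 < 2 * dS r + S r ^+ 2 <= 1.
Hypotheses (s0 : 0 < s) (mu0 : 0 < mu) (smu1 : s * mu < 1).

Local Notation h := (Num.sqrt (s * mu)).
Local Notation th := (theta S s mu).

(** [theta] rescaled to [sqrt mu * theta], which increases from [h] to [1]. *)
Definition level (k : nat) : R := h + (1 - h) * S (k.-1%:R * h).

Lemma step_gt0 : 0 < h. Proof. by rewrite sqrtr_gt0 mulr_gt0. Qed.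

Lemma step_lt1 : h < 1.
Proof. by rewrite -sqrtr1 ltr_sqrt. Qed.

Lemma step_sqr : h ^+ 2 = s * mu.
Proof. by rewrite sqr_sqrtr// ltW// mulr_gt0. Qed.

Lemma grid_ge0 k : 0 <= k%:R * h.
Proof. by rewrite mulr_ge0// ltW// step_gt0. Qed.

Lemma stepE : h = Num.sqrt s * Num.sqrt mu.
Proof. by rewrite sqrtrM// ltW. Qed.

Lemma thetaE k : th k = level k / Num.sqrt mu.
Proof. by rewrite /theta mulrC. Qed.

Lemma level_ge k : h <= level k.
Proof.
rewrite lerDl mulr_ge0//; first by rewrite subr_ge0 ltW// step_lt1.
exact/(S_ge0 S_range)/grid_ge0.
Qed.

Lemma level_gt0 k : 0 < level k.
Proof. exact: lt_le_trans step_gt0 (level_ge k). Qed.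

Lemma level_lt1 k : level k < 1.
Proof.
have := S_lt1 S_range (grid_ge0 k.-1); have := step_lt1.
by rewrite /level; move: (S _) => x; nra.
Qed.

Lemma theta_gt0 k : 0 < th k.
Proof. by rewrite thetaE divr_gt0 ?level_gt0 ?sqrtr_gt0. Qed.

Lemma level_nondecreasing k : (1 <= k)%N -> level k <= level k.+1.
Proof.
case: k => // k _; rewrite /level /= lerD2l ler_wpM2l//.
  by rewrite subr_ge0 ltW// step_lt1.
apply: (S_le S_mono); first exact: grid_ge0.
by rewrite ler_pM2r ?step_gt0// ler_nat.
Qed.

(** Discrete form of [2 S' + S^2 <= 1]: the tangent at the left endpoint of the
    step bounds the increment of [S] by [h (1 - S^2) / 2]. *)
Lemma level_growth k : (1 <= k)%N ->
  level k.+1 ^+ 2 - level k ^+ 2 <= h * level k.+1 * (1 - level k ^+ 2).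
Proof.
case: k => // k _.
have h0 := step_gt0; have h1 := step_lt1.
have mono := @level_nondecreasing k.+1 isT.
have a0 := level_gt0 k.+2.
have tg : S (k.+1%:R * h) - S (k%:R * h) <= h * dS (k%:R * h).
  rewrite (_ : k.+1%:R * h = k%:R * h + h); last by rewrite -natr1; ring.
  by apply: (concave_below_tangent S_der S_conc); [exact: grid_ge0|exact: ltW].
have /andP[_ ric] := S_riccati (grid_ge0 k).
have /andP[x0 x1] := S_range (grid_ge0 k).
move: mono a0 tg ric x0 x1; rewrite /level /=.
move: (S (k%:R * h)) (S (k.+1%:R * h)) (dS _) => x y d.
move: (Num.sqrt _) h0 h1 => u h0 h1 mono a0 tg ric x0 x1.
have grow : y - x <= u * (1 - x ^+ 2) / 2 by nra.
set b := u + (1 - u) * y in mono a0 *; set a := u + (1 - u) * x in mono *.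
have ba : b - a = (1 - u) * (y - x) by rewrite /a/b; ring.
have step1 : b ^+ 2 - a ^+ 2 <= 2 * b * (b - a) by nra.
have step2 : b - a <= (1 - u) * (u * (1 - x ^+ 2) / 2).
  by rewrite ba ler_wpM2l// subr_ge0 ltW.
(* The price of replacing [x] by [a = u + (1 - u) x] has the right sign. *)
have step3 : (1 - u) * (1 - x ^+ 2) <= 1 - a ^+ 2.
  have -> : 1 - a ^+ 2 = (1 - u) * (1 - x ^+ 2) + u * (1 - u) * (1 - x) ^+ 2.
    by rewrite /a; ring.
  by rewrite lerDl !mulr_ge0 ?sqr_ge0// ltW// subr_gt0.
have step4 : b - a <= u * (1 - a ^+ 2) / 2.
  by apply: le_trans step2 _; nra.
by apply: le_trans step1 _; nra.
Qed.

Lemma mu_theta_sqr k : mu * th k ^+ 2 = level k ^+ 2.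
Proof.
rewrite thetaE expr_div_n sqr_sqrtr ?ltW//; field; exact: lt0r_neq0.
Qed.

Lemma sqrts_mu_theta k : Num.sqrt s * mu * th k = h * level k.
Proof.
rewrite thetaE stepE -[X in Num.sqrt s * X](sqr_sqrtr (ltW mu0)).
by field; rewrite gt_eqF// sqrtr_gt0.
Qed.

Lemma sqrts_div_theta k : Num.sqrt s / th k = h / level k.
Proof.
rewrite thetaE stepE; field.
by rewrite !gt_eqF// ?sqrtr_gt0// level_gt0.
Qed.

Lemma sqrts_le_theta k : Num.sqrt s <= th k.
Proof. by rewrite thetaE ler_pdivlMr ?sqrtr_gt0// -stepE level_ge. Qed.

Lemma mu_theta_sqr_le1 k : mu * th k ^+ 2 <= 1.
Proof.
rewrite mu_theta_sqr expr_le1// ?ltW ?level_lt1 ?level_gt0//.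
Qed.

Lemma theta_nondecreasing k : (1 <= k)%N -> th k <= th k.+1.
Proof.
by move=> k1; rewrite !thetaE ler_pM2r ?invr_gt0 ?sqrtr_gt0// level_nondecreasing.
Qed.

Lemma theta_growth k : (1 <= k)%N ->
  (1 - Num.sqrt s / th k.+1) * th k.+1 ^+ 2
    <= (1 - Num.sqrt s * mu * th k.+1) * th k ^+ 2.
Proof.
move=> k1; rewrite -(ler_pM2l mu0) mulrCA mu_theta_sqr [leRHS]mulrCA mu_theta_sqr.
rewrite sqrts_mu_theta sqrts_div_theta.
have -> : (1 - h / level k.+1) * level k.+1 ^+ 2 = level k.+1 ^+ 2 - h * level k.+1.
  by field; rewrite gt_eqF// level_gt0.
by have := level_growth k1; lra.
Qed.

(** The factors [j >= 2] are those by which the energy contracts from step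
    [j - 1] to step [j]; the factor [j = 1] normalizes the initial energy. *)
Definition decay (k : nat) : R := \prod_(1 <= j < k.+1) (1 - h * level j).

Lemma decayS k : decay k.+1 = decay k * (1 - h * level k.+1).
Proof. by rewrite /decay big_nat_recr. Qed.

Lemma contraction_gt0 k : 0 < 1 - h * level k.
Proof.
have := step_lt1; have := step_gt0; have := level_lt1 k; have := level_gt0 k.
by move: (level k) h => a u; nra.
Qed.

Lemma contraction_le1 k : 1 - h * level k <= 1.
Proof. by rewrite gerBl mulr_ge0// ltW// ?step_gt0 ?level_gt0. Qed.

Lemma decay_gt0 k : 0 < decay k.
Proof. by apply: prodr_gt0 => j _; exact: contraction_gt0. Qed.

Lemma decay_le1 k : decay k <= 1.
Proof.
elim: k => [|k IH]; first by rewrite /decay big_nil.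
rewrite decayS -[leRHS]mulr1; apply: ler_pM => //.
- exact/ltW/decay_gt0.
- exact/ltW/contraction_gt0.
- exact: contraction_le1.
Qed.

Hypothesis S0 : S 0 = 0.

Lemma contractionE k :
  1 - h * level k.+1 = (1 - h) * (1 + h * (1 - S (k%:R * h))).
Proof. by rewrite /level /=; ring. Qed.

(** Each factor [1 - h level (j+1)] is [(1 - h) (1 + h (1 - S(j h)))], and
    [1 + v <= exp v]; the summand [h] in the exponent is the factor [j = 0],
    where [S] vanishes. *)
Lemma decay_le_exponential_sum k :
  decay k.+1 <=
    expR (h + \sum_(1 <= j < k.+1) h * (1 - S (j%:R * h))) * (1 - h) ^+ k.+1.
Proof.
have h1 : 0 <= 1 - h by rewrite subr_ge0 ltW// step_lt1.
elim: k => [|k IH].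
  rewrite decayS /decay !big_nil mul1r addr0 contractionE mul0r S0 subr0 mulr1.
  by rewrite expr1 mulrC ler_wpM2r// expR_ge1Dx.
rewrite decayS contractionE big_nat_recr//= addrA expRD exprSr.
rewrite [leRHS]mulrACA [_ * (1 - h)]mulrC; apply: ler_pM => //.
- exact/ltW/decay_gt0.
- rewrite mulr_ge0// addr_ge0// mulr_ge0 ?(ltW step_gt0)//.
  exact/(gap_ge0 S_range)/grid_ge0.
- by rewrite ler_wpM2l// expR_ge1Dx.
Qed.

Lemma decay_le_exponential (xi : R) k : (1 <= k)%N ->
  (\int[lebesgue_measure]_(r in `[0%R, +oo[) (1 - S r)%:E = xi%:E)%E ->
  decay k <= expR (h + xi) * (1 - h) ^+ k.
Proof.
case: k => // k _ hxi; apply: le_trans (decay_le_exponential_sum k) _.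
rewrite ler_wpM2r ?exprn_ge0 ?subr_ge0 ?(ltW step_lt1)// ler_expR lerD2l.
exact: (lower_sum_le S_range S_mono _ step_gt0 hxi).
Qed.

Local Notation c := ((1 - h) * S 1).

Lemma plateau_ge0 : 0 <= c.
Proof. by rewrite mulr_ge0 ?subr_ge0 ?(ltW step_lt1)// (S_ge0 S_range). Qed.

Lemma level_ge_plateau k : 1 <= k%:R * h -> c <= level k.+1.
Proof.
move=> kh; rewrite /level /= ler_wpDl ?(ltW step_gt0)//.
rewrite ler_wpM2l ?subr_ge0 ?(ltW step_lt1)//.
exact: (S_le S_mono).
Qed.

Lemma level_ge_linear k : k%:R * h <= 1 -> c * (k%:R * h) <= level k.+1.
Proof.
move=> kh; rewrite /level /= ler_wpDl ?(ltW step_gt0)// -mulrA.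
rewrite ler_wpM2l ?subr_ge0 ?(ltW step_lt1)// mulrC.
by apply: (concave_above_chord01 S_conc S0); rewrite grid_ge0.
Qed.

(** Only the indices with [1 <= j h] contribute, each a factor at most
    [exp (- h c)]; there are at least [k - 1/h] of them. *)
Lemma decay_le_plateau k : decay k.+1 <= expR (- (c * (k%:R * h - 1))).
Proof.
elim: k => [|k IH].
  rewrite mul0r sub0r mulrN1 opprK; apply: le_trans (decay_le1 _) _.
  by rewrite -[leLHS]expR0 ler_expR plateau_ge0.
have [kh1|kh1] := leP (k.+1%:R * h) 1.
  apply: le_trans (decay_le1 _) _.
  by rewrite -[leLHS]expR0 ler_expR -mulrN mulr_ge0 ?plateau_ge0// opprB subr_ge0.
have -> : - (c * (k.+1%:R * h - 1)) = - (c * (k%:R * h - 1)) + - (h * c).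
  by rewrite -natr1; ring.
rewrite decayS expRD; apply: ler_pM => //.
- exact/ltW/decay_gt0.
- exact/ltW/contraction_gt0.
apply: le_trans (expR_ge1Dx _).
by rewrite lerD2l lerN2 ler_wpM2l ?(ltW step_gt0)// level_ge_plateau// ltW.
Qed.

(** The two terms in the minimum [Csmu] correspond to the two regimes
    [k h <= 1] and [1 < k h]: in the first one [level] grows at least
    linearly, in the second one [level >= c] and the exponential decay
    dominates [(k h)^2]. *)
Lemma polynomial_rate_scaled k :
  (k%:R * h) ^+ 2 * Csmu S s mu * decay k.+1 <= level k.+1 ^+ 2.
Proof.
have c0 := plateau_ge0; have d0 := ltW (decay_gt0 k.+1).
have t0 := grid_ge0 k.
have lin := @level_ge_linear k; have pla := @level_ge_plateau k.
have d1 := decay_le1 k.+1; have dp := decay_le_plateau k.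
rewrite /Csmu -/h; move: lin pla dp; move: (k%:R * h) t0 => t t0 lin pla dp.
move: c c0 lin pla dp => w w0 lin pla dp.
have [t1|t1] := leP t 1.
  apply: (@le_trans _ _ (t ^+ 2 * w ^+ 2 * 1)).
    apply: ler_pM => //.
      by rewrite mulr_ge0 ?sqr_ge0// le_min sqr_ge0 !mulr_ge0 ?exprn_ge0 ?expR_ge0.
    by rewrite ler_wpM2l ?sqr_ge0// ge_min lexx.
  rewrite mulr1 -exprMn mulrC ler_pXn2r ?nnegrE ?lin//.
    by rewrite mulr_ge0.
  exact/ltW/level_gt0.
apply: (@le_trans _ _ (w ^+ 2)); last first.
  rewrite ler_pXn2r ?nnegrE// ?(ltW (level_gt0 _))//.
  exact/pla/ltW.
apply: (@le_trans _ _
  (t ^+ 2 * (w ^+ 4 / 4 * expR (2 - w)) * expR (- (w * (t - 1))))).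
  apply: ler_pM => //.
    by rewrite mulr_ge0 ?sqr_ge0// le_min sqr_ge0 !mulr_ge0 ?exprn_ge0 ?expR_ge0.
  by rewrite ler_wpM2l ?sqr_ge0// ge_min lexx orbT.
(* Square of [u exp (1 - u) <= 1] at [u = w t / 2]. *)
have -> : t ^+ 2 * (w ^+ 4 / 4 * expR (2 - w)) * expR (- (w * (t - 1))) =
    w ^+ 2 * ((w * t / 2) * expR (1 - w * t / 2)) ^+ 2.
  have -> : (w * t / 2 * expR (1 - w * t / 2)) ^+ 2 =
      (w * t / 2) ^+ 2 * (expR (2 - w) * expR (- (w * (t - 1)))).
    rewrite exprMn; congr (_ * _); rewrite expr2 -!expRD; congr expR.
    by field.
  by move: (expR _) (expR _) => e1 e2; field.
rewrite ler_piMr ?sqr_ge0// expr_le1//.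
  by apply: mul_expR1B_le1; rewrite divr_ge0// mulr_ge0.
by rewrite mulr_ge0 ?expR_ge0// divr_ge0// mulr_ge0.
Qed.

Lemma Csmu_gt0 : 0 < dS 0 -> 0 < Csmu S s mu.
Proof.
move=> k0.
have c0 : 0 < c.
  by rewrite mulr_gt0 ?subr_gt0 ?step_lt1// (S1_gt0 S_der S_mono S0).
by rewrite /Csmu lt_min exprn_gt0//= mulr_gt0 ?divr_gt0 ?exprn_gt0 ?expR_gt0.
Qed.

Lemma rate_le_min (xi : R) k : 0 < dS 0 -> (1 < k)%N ->
  (\int[lebesgue_measure]_(r in `[0%R, +oo[) (1 - S r)%:E = xi%:E)%E ->
  decay k / th k ^+ 2 <= s^-1 *
    Num.min (Csmu S s mu * (k%:R - 1) ^+ 2)^-1 (expR (h + xi) * (1 - h) ^+ k).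
Proof.
move=> k0 k1 hxi.
have th2 : 0 < th k ^+ 2 by rewrite exprn_gt0// theta_gt0.
rewrite ler_pdivlMl// le_min [s * (_ / _)]mulrA !ler_pdivrMr//.
apply/andP; split; last first.
  rewrite mulrC; apply: ler_pM; rewrite ?(ltW s0) ?(ltW (decay_gt0 _))//.
    exact: (decay_le_exponential (ltnW k1) hxi).
  rewrite -[leLHS](sqr_sqrtr (ltW s0)) ler_pXn2r ?nnegrE ?sqrtr_ge0//.
    exact: sqrts_le_theta.
  exact/ltW/theta_gt0.
case: k k1 th2 => // k k1 th2; have C0 := Csmu_gt0 k0.
have K0 : 0 < (k.+1%:R - 1 : R) by rewrite -natr1 addrK ltr0n -ltnS.
rewrite ler_pdivlMl ?mulr_gt0 ?exprn_gt0// -(ler_pM2l mu0) mu_theta_sqr.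
apply: le_trans (polynomial_rate_scaled k).
rewrite -natr1 addrK exprMn step_sqr le_eqVlt; apply/orP; left; apply/eqP.
by ring.
Qed.

End theta_bounds.

(** * Limits of theta and of the inertial coefficient *)

Section theta_limits.
Context {R : realType}.
Variables (S dS : R -> R) (s : R).
Hypothesis s0 : 0 < s.

Lemma theta_cvg (m : R) : S r @[r --> +oo] --> (1 : R) -> 0 < m ->
  theta S s m k @[k --> \oo] --> (Num.sqrt m)^-1.
Proof.
move=> S_to1 m0; have h0 : 0 < Num.sqrt (s * m) by rewrite sqrtr_gt0 mulr_gt0.
rewrite -cvg_shiftS /= /theta /=.
have lim : (Num.sqrt m)^-1 * (Num.sqrt (s * m) + (1 - Num.sqrt (s * m)) * 1) =
    (Num.sqrt m)^-1 by ring.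
rewrite -[in X in _ --> X]lim.
apply: cvgM; first exact: cvg_cst.
apply: cvgD; first exact: cvg_cst.
apply: cvgM; first exact: cvg_cst.
apply: (cvg_comp _ _ _ S_to1).
exact: (cvg_comp _ _ cvgr_idn (gt0_cvgMly h0 cvg_id)).
Qed.

Lemma beta_cvg_oo (m : R) : S r @[r --> +oo] --> (1 : R) -> 0 < m ->
  beta S s m k @[k --> \oo] -->
    (1 - Num.sqrt (s * m)) / (1 + Num.sqrt (s * m)).
Proof.
move=> S_to1 m0.
have th_cvg := theta_cvg S_to1 m0.
have thS_cvg : theta S s m k.+1 @[k --> \oo] --> (Num.sqrt m)^-1.
  by rewrite (cvg_shiftS (theta S s m)).
have sm0 : 0 < Num.sqrt m by rewrite sqrtr_gt0.
have ss0 : 0 < Num.sqrt s by rewrite sqrtr_gt0.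
have mE : m = Num.sqrt m ^+ 2 by rewrite sqr_sqrtr// ltW.
have sE : s = Num.sqrt s ^+ 2 by rewrite sqr_sqrtr// ltW.
rewrite sqrtrM ?(ltW s0)//.
(* When [s m = 1] the coefficient is a quotient by zero, hence identically 0,
   which agrees with the limit. *)
have [sm1|sm1] := eqVneq (1 - s * m) 0.
  rewrite /beta sm1 -sqrtrM ?(ltW s0)// (_ : s * m = 1); last by lra.
  rewrite sqrtr1 subrr mul0r.
  rewrite [X in X @ _](_ : _ = fun=> 0); last first.
    by apply/funext => k; rewrite mul0r invr0 mulr0.
  exact: cvg_cst.
have lim : ((Num.sqrt m)^-1 - Num.sqrt s) *
    (1 - m * Num.sqrt s * (Num.sqrt m)^-1) / ((1 - s * m) * (Num.sqrt m)^-1) =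
    (1 - Num.sqrt s * Num.sqrt m) / (1 + Num.sqrt s * Num.sqrt m).
  move: sm1; rewrite [in 1 - s * m]sE [in 1 - _ * m]mE [in m * Num.sqrt s]mE.
  move: (Num.sqrt m) (Num.sqrt s) sm0 ss0 => u v u0 v0 uv1.
  by field; rewrite exprMn uv1 (gt_eqF u0) gt_eqF ?addr_gt0 ?mulr_gt0.
rewrite -lim; apply: cvgM.
  apply: cvgM; first by apply: cvgB => //; exact: cvg_cst.
  apply: cvgB; first exact: cvg_cst.
  by apply: cvgM => //; exact: cvg_cst.
apply: cvgV; first by rewrite mulf_neq0// invr_neq0// gt_eqF.
by apply: cvgM => //; exact: cvg_cst.
Qed.

Lemma step_cvg0 : Num.sqrt (s * m) @[m --> 0^'+] --> (0 : R).
Proof.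
have c : {for 0, continuous (fun m => Num.sqrt (s * m))}.
  by apply: continuous_comp; [exact: mulrl_continuous|exact: sqrt_continuous].
by have := cvg_at_right_filter c; rewrite mulr0 sqrtr0.
Qed.

Hypothesis S_der : derivative_within `[0, +oo[ S dS.
Hypothesis S0 : S 0 = 0.

Lemma slope_cvg (j : nat) :
  S (j%:R * Num.sqrt (s * m)) / Num.sqrt (s * m) @[m --> 0^'+] --> dS 0 * j%:R.
Proof.
have [->|j0] := eqVneq j 0%N.
  rewrite mulr0 [X in X @ _](_ : _ = fun=> 0); first exact: cvg_cst.
  by apply/funext => m; rewrite !mul0r S0 mul0r.
have jgt0 : 0 < j%:R :> R by rewrite ltr0n lt0n.
rewrite [X in X @ _](_ : _ =
    fun m => S (j%:R * Num.sqrt (s * m)) / (j%:R * Num.sqrt (s * m)) * j%:R);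
    last first.
  apply/funext => m.
  by rewrite [_ * Num.sqrt _]mulrC invfM mulrA mulfVK ?gt_eqF// [_ * j%:R]mulrC.
apply: cvgM; last exact: cvg_cst.
apply/cvgrPdist_lt => e e0.
have [d d0 near_zero] := derivative_within_near S_der (lexx 0) e0.
have /cvgrPdist_lt /(_ (d / j%:R)) := step_cvg0.
rewrite divr_gt0// => /(_ isT) small.
near=> m.
have m0 : 0 < m by near: m; exact: nbhs_right_gt.
have h0 : 0 < Num.sqrt (s * m) by rewrite sqrtr_gt0 mulr_gt0.
have := near_zero (j%:R * Num.sqrt (s * m)); rewrite !subr0 S0 subr0; apply.
- by rewrite mulr_ge0// ltW.
- by rewrite gt_eqF// mulr_gt0.
rewrite gtr0_norm ?mulr_gt0// mulrC -ltr_pdivlMr//.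
have : `|0 - Num.sqrt (s * m)| < d / j%:R by near: m.
by rewrite sub0r normrN gtr0_norm.
Unshelve. all: by end_near. Qed.

(** After division by [sqrt s], everything is a rational expression in
    [h = sqrt (s m)] and the slopes [S(j h) / h], regular at [h = 0]. *)
Lemma beta_cvg_mu0 (k : nat) : 0 < dS 0 -> (1 <= k)%N ->
  beta S s m k @[m --> 0^'+] -->
    dS 0 * (k%:R - 1) / (1 + dS 0 * k%:R).
Proof.
move=> kappa0; case: k => // k _.
pose D j m := S (j%:R * Num.sqrt (s * m)) / Num.sqrt (s * m).
pose h (m : R) : R := Num.sqrt (s * m).
have ss0 : 0 < Num.sqrt s by rewrite sqrtr_gt0.
suff : (1 - h m) * D k m * (1 - h m * (h m + (1 - h m) * (h m * D k.+1 m))) /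
    ((1 - h m * h m) * (1 + (1 - h m) * D k.+1 m)) @[m --> 0^'+] -->
    (1 - 0) * (dS 0 * k%:R) * (1 - 0 * (0 + (1 - 0) * (0 * (dS 0 * k.+1%:R)))) /
    ((1 - 0 * 0) * (1 + (1 - 0) * (dS 0 * k.+1%:R))).
  rewrite !(subr0, mul0r, mulr1, mul1r) -[in k.+1%:R - 1]natr1 addrK.
  apply: cvg_trans; apply: near_eq_cvg; near=> m.
  have m0 : 0 < m by near: m; exact: nbhs_right_gt.
  have sm0 : 0 < Num.sqrt m by rewrite sqrtr_gt0.
  have hE : h m = Num.sqrt s * Num.sqrt m by rewrite /h sqrtrM// ltW.
  have thE j : theta S s m j.+1 = Num.sqrt s * (1 + (1 - h m) * D j m).
    rewrite /theta /D -/(h m) hE.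
    by field; rewrite !gt_eqF.
  rewrite /beta !thE.
  have smE : s * m = h m * h m by rewrite -expr2 sqr_sqrtr// mulr_ge0// ltW.
  have mE : m * Num.sqrt s * Num.sqrt s = h m * h m.
    by rewrite -mulrA -expr2 sqr_sqrtr ?(ltW s0)// mulrC.
  rewrite [m * _ * (_ * _)]mulrA mE smE.
  have -> : Num.sqrt s * (1 + (1 - h m) * D k m) - Num.sqrt s =
    Num.sqrt s * ((1 - h m) * D k m) by ring.
  have -> : 1 - h m * h m * (1 + (1 - h m) * D k.+1 m) =
    1 - h m * (h m + (1 - h m) * (h m * D k.+1 m)) by ring.
  have cancel_s a b d e :
      Num.sqrt s * a * b / (d * (Num.sqrt s * e)) = a * b / (d * e).
    by rewrite mulrCA -[_ * a * b]mulrA -mulf_div divff ?mul1r// gt_eqF.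
  by rewrite cancel_s.
have hc : h m @[m --> 0^'+] --> 0 := step_cvg0.
have Dc j : D j m @[m --> 0^'+] --> dS 0 * j%:R := @slope_cvg j.
have one : (fun=> 1 : R) @ (0 : R)^'+ --> (1 : R) by exact: cvg_cst.
have hc1 : 1 - h m @[m --> 0^'+] --> (1 - 0 : R) by exact: cvgB.
apply: cvgM; last apply: cvgV.
- apply: cvgM; first exact: cvgM.
  apply: cvgB => //; apply: cvgM => //; apply: cvgD => //.
  by apply: cvgM => //; exact: cvgM.
- by rewrite !(mul0r, subr0, mul1r) gt_eqF// ltr_wpDr// mulr_ge0// ltW.
- by apply: cvgM; [apply: cvgB => //; exact: cvgM|apply: cvgD => //; exact: cvgM].
Unshelve. all: by end_near. Qed.

End theta_limits.

(** * Inner product and norm *)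

Section inner_product.
Context {R : realType} {H : completeNormedModType R}.
Variable ip : {dot H for (@idfun R)}.
Hypothesis ip_norm : induces_norm ip.

Lemma ipC u v : ip u v = ip v u.
Proof. by rewrite hermC expr0 mul1r. Qed.

Lemma ipDl u v w : ip (u + v) w = ip u w + ip v w. Proof. exact: linearDl. Qed.
Lemma ipNl u w : ip (- u) w = - ip u w. Proof. exact: linearNl. Qed.
Lemma ipZl a u w : ip (a *: u) w = a * ip u w. Proof. exact: linearZl_LR. Qed.
Lemma ipDr u v w : ip w (u + v) = ip w u + ip w v. Proof. exact: linearDr. Qed.
Lemma ipNr u w : ip w (- u) = - ip w u. Proof. exact: linearNr. Qed.
Lemma ipZr a u w : ip w (a *: u) = a * ip w u.
Proof. by rewrite ipC ipZl ipC. Qed.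

Definition ipE := (ipDl, ipNl, ipZl, ipDr, ipNr, ipZr).

(** Reduces identities between vectors to identities between scalars, which
    [ring] and [field] decide. *)
Lemma ip_ext u v : (forall w, ip u w = ip v w) -> u = v.
Proof.
move=> uv; apply/subr0_eq/normr0_eq0/eqP; rewrite -sqrf_eq0 ip_norm.
by rewrite !ipDl ipNl uv subrr.
Qed.

Lemma ip_young a u v : 0 < a -> 2 * ip u v <= a^-1 * `|u| ^+ 2 + a * `|v| ^+ 2.
Proof.
move=> a0; have : 0 <= a^-1 * `|u - a *: v| ^+ 2.
  by rewrite mulr_ge0 ?sqr_ge0// invr_ge0 ltW.
rewrite -(subr_ge0 (2 * ip u v)) !ip_norm !ipE (ipC v u).
by congr (is_true (0 <= _)); field; rewrite gt_eqF.
Qed.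

Lemma ip_le_of_norm_le u v a : 0 <= a -> `|u| <= a * `|v| -> ip u v <= a * `|v| ^+ 2.
Proof.
rewrite le_eqVlt => /orP[/eqP<-|a0 uv].
  rewrite !mul0r normr_le0 => /eqP ->.
  by rewrite -(scale0r 0) ipZl mul0r.
have /(ler_pM (normr_ge0 _) (normr_ge0 _) uv) : `|u| <= a * `|v| by [].
have := ip_young u v a0; rewrite -expr2.
have : a^-1 * a = 1 by rewrite mulVf// gt_eqF.
have : 0 < a^-1 by rewrite invr_gt0.
move: (ip u v) a^-1 `|u| `|v| => b c n m; nra.
Qed.

Lemma normsq_conv_le (t : R) (u v : H) : 0 <= t <= 1 ->
  `|(1 - t) *: u + t *: v| ^+ 2 <= (1 - t) * `|u| ^+ 2 + t * `|v| ^+ 2.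
Proof.
move=> /andP[t0 t1]; rewrite -subr_ge0 !ip_norm !ipE.
have : 0 <= t * (1 - t) * ip (u - v) (u - v).
  by rewrite -ip_norm !mulr_ge0 ?sqr_ge0 ?subr_ge0.
by rewrite !ipE (ipC v u); congr (is_true (0 <= _)); ring.
Qed.

Lemma three_point (a b c : H) :
  ip (a - b) (c - b) = (`|a - b| ^+ 2 + `|b - c| ^+ 2 - `|a - c| ^+ 2) / 2.
Proof.
rewrite !ip_norm !ipE (ipC b a) (ipC c a) (ipC c b).
by field.
Qed.

End inner_product.

(** * The descent lemma *)

Section smooth_convex.
Context {R : realType} {H : completeNormedModType R}.
Variable ip : {dot H for (@idfun R)}.
Hypothesis ip_norm : induces_norm ip.
Variables (f : H -> R) (gradf : H -> H) (L : R).
Hypothesis L0 : 0 < L.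
Hypothesis f_convex : forall x y, f x + ip (gradf x) (y - x) <= f y.
Hypothesis gradf_lip : forall x y, `|gradf x - gradf y| <= L * `|x - y|.

(** Induction over [n] equal pieces of the segment, with the gradient
    inequality at the far end of each piece: the gradient has moved by at most
    [L (i + 1) / n * |d|] there, and summation replaces an integration of the
    gradient along the segment. *)
Lemma descent_subdivided (x d : H) (n i : nat) : (0 < n)%N ->
  f (x + (i%:R / n%:R) *: d) <= f x + i%:R / n%:R * ip (gradf x) d +
    L * `|d| ^+ 2 / n%:R ^+ 2 * (i%:R * (i%:R + 1) / 2).
Proof.
move=> n0; have n0' : 0 < n%:R :> R by rewrite ltr0n.
elim: i => [|i IH]; first by rewrite !(mul0r, mulr0, scale0r, addr0).
set x' := x + _; set x0 := x + _ in IH.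
have step : f x' <= f x0 + n%:R^-1 * ip (gradf x') d.
  have := f_convex x' x0.
  have -> : x0 - x' = - (n%:R^-1 *: d).
    apply: (ip_ext ip_norm) => w; rewrite !ipE -natr1; field.
    by rewrite gt_eqF.
  by rewrite ipNr ipZr; lra.
have grow : ip (gradf x') d <= ip (gradf x) d + L * (i.+1%:R / n%:R) * `|d| ^+ 2.
  have : ip (gradf x' - gradf x) d <= L * (i.+1%:R / n%:R) * `|d| ^+ 2.
    apply: (ip_le_of_norm_le ip_norm).
      by rewrite mulr_ge0 ?divr_ge0// ltW.
    apply: le_trans (gradf_lip _ _) _.
    rewrite /x' addrC addKr normrZ ger0_norm ?divr_ge0//; lra.
  by rewrite ipDl ipNl; lra.
have n1 : 0 < n%:R^-1 :> R by rewrite invr_gt0.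
apply: le_trans step _; apply: le_trans (lerD IH (ler_wpM2l (ltW n1) grow)) _.
rewrite -natr1 le_eqVlt; apply/orP; left; apply/eqP; field.
by rewrite gt_eqF.
Qed.

(** The error of the subdivision with [n] pieces is [L |y - x|^2 / (2 n)]. *)
Lemma descent x y : f y <= f x + ip (gradf x) (y - x) + L / 2 * `|y - x| ^+ 2.
Proof.
apply/ler_addgt0Pr => e e0; set d := y - x.
have yE : y = x + d by rewrite addrC subrK.
pose K := L / 2 * `|d| ^+ 2.
have K0 : 0 <= K by rewrite mulr_ge0 ?sqr_ge0// divr_ge0// ltW.
pose n := (Num.truncn (K / e)).+1.
have n0 : 0 < n%:R :> R by [].
have Kn : K / n%:R <= e.
  rewrite ler_pdivrMr// mulrC -ler_pdivrMr// ltW//.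
  exact: truncnS_gt.
have := descent_subdivided x d n (ltn0Sn _ : (0 < n)%N).
rewrite divff ?gt_eqF// scale1r mul1r -yE => h; apply: le_trans h _.
rewrite -[leRHS]addrA lerD2l -/K.
have -> : L * `|d| ^+ 2 / n%:R ^+ 2 * (n%:R * (n%:R + 1) / 2) = K + K / n%:R.
  by rewrite /K; field; rewrite gt_eqF.
by rewrite lerD2l.
Qed.

End smooth_convex.

(** * Minimizers of composite objectives and the proximal map *)

Section composite_minimizer.
Context {R : realType} {H : completeNormedModType R}.
Variable ip : {dot H for (@idfun R)}.
Hypothesis ip_norm : induces_norm ip.
Variable g : H -> \bar R.
Hypothesis g_proper : proper_fun g.
Hypothesis g_convex : econvex g.

Lemma proper_fineK v : (g v < +oo)%E -> g v = (fine (g v))%:E.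
Proof.
move=> gv; rewrite fineK// fin_numE (lt_eqF gv) andbT; exact: g_proper.1.
Qed.

(** Moving from the minimizer [p] towards [v], the objective [q + g] varies to
    first order by at most [l + g v - g p].  This serves twice: at [xstar] with
    the smooth part [f], and at a proximal point with the squared distance. *)
Lemma minimizer_first_order (q : H -> R) (p v : H) (l K gp gv : R) :
  (forall w, (q p)%:E + g p <= (q w)%:E + g w)%E ->
  (forall t, 0 < t <= 1 -> q (t *: v + (1 - t) *: p) <= q p + t * l + t ^+ 2 * K) ->
  g p = gp%:E -> g v = gv%:E -> gp - l <= gv.
Proof.
move=> p_min q_le gpE gvE; rewrite lerBlDr -subr_ge0 -addrA.
apply: (@linear_coef_ge0 _ _ K) => t t01; have /andP[t0 t1] := t01.
have := @g_convex v p t; rewrite (ltW t0) t1 => /(_ isT) gt_le.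
have := p_min (t *: v + (1 - t) *: p).
have /leeD/(_ gt_le) : ((q (t *: v + (1 - t) *: p))%:E <=
   (q p + t * l + t ^+ 2 * K)%:E)%E by rewrite lee_fin q_le.
move=> /[swap] /le_trans /[apply].
rewrite gpE gvE -!EFinM -!EFinD lee_fin; lra.
Qed.

Lemma prox_first_order (lam : R) (u p v : H) (gp gv : R) : 0 < lam ->
  argmin (fun v => g v + ((2 * lam)^-1 * `|v - u| ^+ 2)%:E)%E p ->
  g p = gp%:E -> g v = gv%:E -> gp + lam^-1 * ip (u - p) (v - p) <= gv.
Proof.
move=> lam0 p_min gpE gvE.
have lam_neq0 : lam != 0 by rewrite gt_eqF.
rewrite -[_ * _]opprK.
apply: (minimizer_first_order (q := fun w => (2 * lam)^-1 * `|w - u| ^+ 2)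
  (K := (2 * lam)^-1 * `|v - p| ^+ 2) _ _ gpE gvE).
  by move=> w; rewrite addeC [leRHS]addeC; exact: p_min.
move=> t _; rewrite !ip_norm le_eqVlt; apply/orP; left; apply/eqP.
by rewrite !(ipE ip) (ipC ip v p) (ipC ip u p) (ipC ip v u); field.
Qed.

Hypothesis g_lsc : lower_semicontinuous g.

(** The quadratic term absorbs the linear one by Young's inequality. *)
Lemma prox_objective_bounded (lam c : R) (a u v : H) : 0 < lam ->
  (forall v, (c + ip a v)%:E <= g v)%E ->
  ((c + ip a u - lam / 2 * `|a| ^+ 2)%:E <=
     g v + ((2 * lam)^-1 * `|v - u| ^+ 2)%:E)%E.
Proof.
move=> lam0 minor.
apply: (@le_trans _ _ ((c + ip a v)%:E + ((2 * lam)^-1 * `|v - u| ^+ 2)%:E)%E).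
  rewrite -EFinD lee_fin.
  have := ip_young ip_norm (- a) (v - u) (_ : 0 < lam^-1); rewrite invr_gt0 invrK.
  move=> /(_ lam0); rewrite normrN !(ipE ip) invfM.
  by move: lam^-1 => il; lra.
by rewrite leeD2r.
Qed.

(** Strong convexity of the quadratic term makes minimizing sequences Cauchy
    (through the value at midpoints), and lower semicontinuity of [g] makes
    the limit a minimizer. *)
Lemma prox_argmin (lam c : R) (a u : H) : 0 < lam ->
  (forall v, (c + ip a v)%:E <= g v)%E ->
  argmin (fun v => g v + ((2 * lam)^-1 * `|v - u| ^+ 2)%:E)%E (prox lam g u).
Proof.
move=> lam0 minor; apply: getPex.
set k := (2 * lam)^-1; pose F v := (g v + (k * `|v - u| ^+ 2)%:E)%E.
have k0 : 0 < k by rewrite invr_gt0 mulr_gt0.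
pose E := [set r | exists v, F v = r%:E].
have FE v r : F v = r%:E -> g v = (r - k * `|v - u| ^+ 2)%:E.
  rewrite /F EFinB => <-; by rewrite addeK.
have [v0 gv0] := g_proper.2.
have Eb : has_inf E.
  split.
    exists (fine (g v0) + k * `|v0 - u| ^+ 2), v0.
    by rewrite /F [g v0]proper_fineK.
  exists (c + ip a u - lam / 2 * `|a| ^+ 2) => r [v Fv].
  by rewrite -lee_fin -Fv; exact: prox_objective_bounded.
pose m := inf E.
have m_le v : (m%:E <= F v)%E.
  have [gv|] := ltP (g v) +oo%E; last first.
    by rewrite leye_eq => /eqP gv; rewrite /F gv leey.
  rewrite /F [g v]proper_fineK// -EFinD lee_fin; apply: ge_inf; first exact: Eb.2.
  by exists v; rewrite /F [g v]proper_fineK.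
have near_min (n : nat) : exists v, exists2 r, F v = r%:E & r < m + n.+1%:R^-1.
  have n1 : 0 < n.+1%:R^-1 :> R by rewrite invr_gt0.
  have [r [v Fv] rm] := inf_adherent n1 Eb.
  by exists v, r.
have [x x_min] := choice near_min.
have mid v w r q : F v = r%:E -> F w = q%:E ->
  k / 4 * `|v - w| ^+ 2 <= (r + q) / 2 - m.
  move=> Fv Fw.
  have := @g_convex v w 2^-1; rewrite invr_ge0 ler0n invf_le1// ler1n => /(_ isT).
  rewrite (FE _ _ Fv) (FE _ _ Fw) -!EFinM -EFinD => gmid.
  have := le_trans (m_le (2^-1 *: v + (1 - 2^-1) *: w)) (leeD2r _ gmid).
  rewrite -EFinD lee_fin !ip_norm !(ipE ip) (ipC ip w v) (ipC ip u v) (ipC ip u w).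
  lra.
have k_cancel b : k * (2 / k * b) = 2 * b.
  by rewrite mulrA [k * _]mulrC divfK// gt_eqF.
have x_close i j : `|x i - x j| ^+ 2 <= 2 / k * (i.+1%:R^-1 + j.+1%:R^-1).
  have [r Fi ri] := x_min i; have [q Fj qj] := x_min j.
  have close := mid _ _ _ _ Fi Fj; rewrite -(ler_pM2l k0).
  rewrite k_cancel.
  move: close ri qj; move: (_ ^+ 2) i.+1%:R^-1 j.+1%:R^-1 => d b c'.
  by lra.
have x_cvg : cvgn x.
  apply/cauchy_cvgP/cauchy_exP => e e0.
  have e2 : 0 < 4 / (k * e ^+ 2) by rewrite divr_gt0// mulr_gt0// exprn_gt0.
  pose N := Num.truncn (4 / (k * e ^+ 2)).
  exists (x N); exists N => // n /= Nn; rewrite -ball_normE /=.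
  have N1 : N.+1%:R^-1 < k * e ^+ 2 / 4.
    rewrite -[ltRHS]invrK ltf_pV2 ?posrE ?invr_gt0 ?divr_gt0 ?mulr_gt0 ?exprn_gt0//.
    by rewrite invf_div truncnS_gt.
  have n1 : n.+1%:R^-1 <= N.+1%:R^-1 :> R by rewrite lef_pV2 ?posrE// ler_nat.
    rewrite -(@ltr_pXn2r _ 2) ?nnegrE ?(ltW e0)//.
  apply: le_lt_trans (x_close _ _) _.
  rewrite -(ltr_pM2l k0).
  rewrite k_cancel; move: N1 n1; move: N.+1%:R^-1 n.+1%:R^-1 => b d.
  by lra.
pose y := limn x.
have x_y : x n @[n --> \oo] --> y := x_cvg.
(* If [F y > m], then [g] stays above some [b > m - k |y - u|^2] near [y],
   while the quadratic term converges: [F (x n)] would stay away from [m]. *)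
have Fy : (F y <= m%:E)%E.
  rewrite leNgt; apply/negP => mFy.
  have [b mb bg] : exists2 b, m - k * `|y - u| ^+ 2 < b & (b%:E < g y)%E.
    move: mFy; rewrite /F.
    have [gy|] := ltP (g y) +oo%E; last first.
      rewrite leye_eq => /eqP -> _.
      by exists (m - k * `|y - u| ^+ 2 + 1); rewrite ?ltry// ltrDl.
    rewrite [g y]proper_fineK// -EFinD lte_fin => my.
    exists ((m - k * `|y - u| ^+ 2 + fine (g y)) / 2); rewrite ?lte_fin; lra.
  have [V yV Vb] := g_lsc bg.
  pose e := (b - (m - k * `|y - u| ^+ 2)) / 2.
  have e0 : 0 < e by rewrite divr_gt0// subr_gt0.
  have nrm : k * `|x n - u| ^+ 2 @[n --> \oo] --> k * `|y - u| ^+ 2.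
    apply: cvgM; first exact: cvg_cst.
    rewrite expr2; apply: cvgM; apply: cvg_norm; apply: cvgB => //; exact: cvg_cst.
  suff : \forall n \near \oo, False by move=> [N _ /(_ N (leqnn N))].
  have /cvgrPdist_lt /(_ e e0) nrm_near := nrm.
  have /cvgrPdist_lt /(_ e e0) inv_near := @cvg_harmonic R.
  near=> n.
  have xV : V (x n) by near: n; exact: x_y.
  have : `|k * `|y - u| ^+ 2 - k * `|x n - u| ^+ 2| < e by near: n.
  have : `|0 - n.+1%:R^-1| < e by near: n.
  have := Vb _ xV; have [r Fr rm] := x_min n.
  rewrite (FE _ _ Fr) lte_fin !ltr_norml /e => br /andP[inv_e _] /andP[_ nrm_e].
  by move: inv_e nrm_e rm; move: n.+1%:R^-1 => d; lra.
by exists y => v; exact: le_trans Fy (m_le v).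
Unshelve. all: by end_near. Qed.

End composite_minimizer.

(** * The decrease over one iteration *)

Section one_step.
Context {R : realType} {H : completeNormedModType R}.
Variable ip : {dot H for (@idfun R)}.
Hypothesis ip_norm : induces_norm ip.
Variables (f : H -> R) (gradf : H -> H) (mu s : R).
Hypothesis f_sconvex : strongly_convex ip mu f gradf.
Hypothesis f_smooth : forall x y,
  f y <= f x + ip (gradf x) (y - x) + (2 * s)^-1 * `|y - x| ^+ 2.
Variables (t la : R).
Hypotheses (mu0 : 0 < mu) (t01 : 0 < t <= 1) (la0 : 0 < la).
Hypotheses (tla : t * la = s) (mula1 : mu * la <= 1).
Variables x y z x' z' p : H.

Local Notation w := (z - (mu * la) *: (z - y)).
Hypothesis yE : y = (1 - t) *: x + t *: w.
Hypothesis x'E : x' = (1 - t) *: x + t *: z'.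

(** Up to the factor [la / t = theta^2], the decrease of the energy. *)
Definition step_decrease (Fx Fx' Fp : R) :=
  Fx' - Fp + t / (2 * la) * `|z' - p| ^+ 2 <=
  (1 - t) * (Fx - Fp) + t / (2 * la) * (1 - mu * la) * `|z - p| ^+ 2.

(** [w] is the convex combination of [z] and [y] with weights [1 - mu la] and
    [mu la]. *)
Lemma anchor_sqr_le : t / (2 * la) * `|w - p| ^+ 2 <=
  t / (2 * la) * (1 - mu * la) * `|z - p| ^+ 2 + t * mu / 2 * `|p - y| ^+ 2.
Proof.
have /andP[t0 _] := t01.
have wE : w - p = (1 - mu * la) *: (z - p) + (mu * la) *: (y - p).
  by apply: (ip_ext ip_norm) => v; rewrite !(ipE ip); ring.
have -> : t * mu / 2 = t / (2 * la) * (mu * la) by field; rewrite gt_eqF.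
have q0 : 0 < t / (2 * la) by rewrite divr_gt0// mulr_gt0.
rewrite -!(mulrA (t / (2 * la))) -mulrDr ler_pM2l// wE (distrC p).
apply: (normsq_conv_le ip_norm).
by rewrite mula1 mulr_ge0 ?ltW.
Qed.

(** Strong convexity enters at [p], where its quadratic term will offset the
    one in [anchor_sqr_le]. *)
Lemma linearization_le :
  f y + ip (gradf y) ((1 - t) *: x + t *: p - y) <=
  (1 - t) * f x + t * f p - t * mu / 2 * `|p - y| ^+ 2.
Proof.
have /andP[t0 t1] := t01.
have cx : f y + ip (gradf y) (x - y) <= f x.
  apply: le_trans (f_sconvex y x); rewrite lerDl mulr_ge0 ?sqr_ge0//.
  by rewrite divr_ge0// ltW.
have cp := f_sconvex y p.
have -> : ip (gradf y) ((1 - t) *: x + t *: p - y) =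
    (1 - t) * ip (gradf y) (x - y) + t * ip (gradf y) (p - y).
  by rewrite !(ipE ip); ring.
have := lerD (ler_wpM2l (_ : 0 <= 1 - t) cx) (ler_wpM2l (ltW t0) cp).
by rewrite subr_ge0 => /(_ t1); lra.
Qed.

(** Since [x' - y = t (z' - w)], the smoothness error
    [|x' - y|^2 / (2 s)] equals [t / (2 la) |z' - w|^2] and cancels against the
    three-point identity in the proximal inequality. *)
Lemma two_sequence_step (gx gx' gz' gp : R) :
  gx' <= (1 - t) * gx + t * gz' ->
  gz' + la^-1 * ip (w - la *: gradf y - z') (p - z') <= gp ->
  step_decrease (f x + gx) (f x' + gx') (f p + gp).
Proof.
have /andP[t0 t1] := t01 => gx'_le prox_le.
have prox_le' : t * gz' +
    t / (2 * la) * (`|w - z'| ^+ 2 + `|z' - p| ^+ 2 - `|w - p| ^+ 2) +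
    t * ip (gradf y) (z' - p) <= t * gp.
  apply: le_trans (ler_wpM2l (ltW t0) prox_le).
  rewrite le_eqVlt; apply/orP; left; apply/eqP.
  have -> : ip (w - la *: gradf y - z') (p - z') =
      ip (w - z') (p - z') + la * ip (gradf y) (z' - p).
    by rewrite !(ipE ip); ring.
  by rewrite (three_point ip_norm); field; rewrite gt_eqF.
have := f_smooth y x'.
have -> : x' - y = t *: (z' - w).
  by rewrite x'E {1}yE; apply: (ip_ext ip_norm) => v; rewrite !(ipE ip); ring.
have -> : ip (gradf y) (t *: (z' - w)) =
    ip (gradf y) ((1 - t) *: x + t *: p - y) + t * ip (gradf y) (z' - p).
  by rewrite {4}yE !(ipE ip); ring.
rewrite normrZ gtr0_norm// exprMn -tla (distrC z').
have -> : (2 * (t * la))^-1 * (t ^+ 2 * `|w - z'| ^+ 2) =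
    t / (2 * la) * `|w - z'| ^+ 2.
  by field; rewrite !gt_eqF.
have := linearization_le; have := anchor_sqr_le; rewrite /step_decrease.
lra.
Qed.

(** The proximal inequality is used at the point [(1 - t) x + t p], whose
    differences with [x'] and [y] are [t (p - z')] and [t (p - w)]. *)
Lemma one_sequence_step (gx gx' gv gp : R) :
  gv <= (1 - t) * gx + t * gp ->
  gx' + s^-1 * ip (y - s *: gradf y - x') ((1 - t) *: x + t *: p - x') <= gv ->
  step_decrease (f x + gx) (f x' + gx') (f p + gp).
Proof.
have /andP[t0 t1] := t01; have s0 : 0 < s by rewrite -tla mulr_gt0.
set v := _ + t *: p => gv_le; have := f_smooth y x'.
have -> : ip (y - s *: gradf y - x') (v - x') =
    ip (y - x') (v - x') - s * ip (gradf y) (v - y) + s * ip (gradf y) (x' - y).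
  by rewrite !(ipE ip); ring.
rewrite (three_point ip_norm) (distrC x').
have -> : x' - v = t *: (z' - p).
  by rewrite x'E; apply: (ip_ext ip_norm) => u; rewrite !(ipE ip); ring.
have -> : y - v = t *: (w - p).
  by rewrite {1}yE; apply: (ip_ext ip_norm) => u; rewrite !(ipE ip); ring.
rewrite !normrZ gtr0_norm// !exprMn.
have qE a : t / (2 * la) * a = (2 * s)^-1 * (t ^+ 2 * a).
  by rewrite -tla; field; rewrite !gt_eqF.
have := linearization_le; have := anchor_sqr_le; rewrite /step_decrease !qE.
have sE a b c : s^-1 * (a / 2 - s * b + s * c) = (2 * s)^-1 * a - b + c.
  by field; rewrite gt_eqF.
rewrite -/v sE; lra.
Qed.

End one_step.

(** * Energy decay along the iterates *)

Section convergence.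
Context {R : realType} {H : completeNormedModType R}.
Variable ip : {dot H for (@idfun R)}.
Hypothesis ip_norm : induces_norm ip.
Variables (f : H -> R) (gradf : H -> H) (g : H -> \bar R) (mu L s : R).
Hypotheses (mu0 : 0 < mu) (L0 : 0 < L) (mu_lt_L : mu < L).
Hypothesis f_sconvex : strongly_convex ip mu f gradf.
Hypothesis f_lip : L.-lipschitz gradf.
Hypotheses (g_proper : proper_fun g) (g_lsc : lower_semicontinuous g).
Hypothesis g_convex : econvex g.
Hypothesis s_range : 0 < s <= L^-1.
Variable xstar : H.
Hypothesis xstar_min : argmin (fun v => (f v)%:E + g v)%E xstar.

Lemma grad_ineq x y : f x + ip (gradf x) (y - x) <= f y.
Proof.
apply: le_trans (f_sconvex x y); rewrite lerDl mulr_ge0 ?sqr_ge0//.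
by rewrite divr_ge0// ltW.
Qed.

Lemma grad_lip x y : `|gradf x - gradf y| <= L * `|x - y|.
Proof. by have := f_lip; move=> /(_ (x, y)) /=; apply. Qed.

Lemma f_descent x y :
  f y <= f x + ip (gradf x) (y - x) + L / 2 * `|y - x| ^+ 2.
Proof. exact: (descent ip_norm L0 grad_ineq grad_lip). Qed.

Lemma f_smooth x y :
  f y <= f x + ip (gradf x) (y - x) + (2 * s)^-1 * `|y - x| ^+ 2.
Proof.
apply: le_trans (f_descent x y) _; rewrite lerD2l ler_wpM2r ?sqr_ge0//.
have /andP[s0 sL] := s_range.
by rewrite invfM mulrC ler_pM2l ?invr_gt0// -[leLHS]invrK lef_pV2 ?posrE ?invr_gt0.
Qed.

Lemma smu_lt1 : s * mu < 1.
Proof.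
have /andP[s0 sL] := s_range; apply: (@le_lt_trans _ _ (L^-1 * mu)).
  by rewrite ler_pM2r.
by rewrite mulrC ltr_pdivrMr// mul1r.
Qed.

Lemma xstar_dom : edom g xstar.
Proof.
have [v gv] := g_proper.2; have := xstar_min v.
rewrite (proper_fineK g_proper gv) -EFinD => h.
have := le_lt_trans h (ltry _); rewrite /edom /=.
by case: (g xstar) => [r||] //=; rewrite !ltry.
Qed.

(** [- gradf xstar] is a subgradient of [g] at [xstar]. *)
Lemma g_affine_minorant :
  exists c a, forall v, ((c + ip a v)%:E <= g v)%E.
Proof.
pose gs := fine (g xstar).
have gsE : g xstar = gs%:E by apply: proper_fineK => //; exact: xstar_dom.
exists (gs + ip (gradf xstar) xstar), (- gradf xstar) => v.
have [gv|] := ltP (g v) +oo%E; last first.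
  by rewrite leye_eq => /eqP ->; rewrite leey.
rewrite (proper_fineK g_proper gv) lee_fin.
have := minimizer_first_order g_convex
  (l := ip (gradf xstar) (v - xstar)) (K := L / 2 * `|v - xstar| ^+ 2)
  xstar_min _ gsE (proper_fineK g_proper gv).
rewrite !(ipE ip) => h; rewrite -addrA; apply: le_trans (h _); first by lra.
move=> t /andP[t0 t1].
apply: le_trans (f_descent xstar _) _.
have -> : t *: v + (1 - t) *: xstar - xstar = t *: (v - xstar).
  by apply: (ip_ext ip_norm) => u; rewrite !(ipE ip); ring.
rewrite normrZ gtr0_norm// !(ipE ip) le_eqVlt; apply/orP; left; apply/eqP.
by ring.
Qed.

Lemma g_conv_real (t : R) (u v : H) : 0 <= t <= 1 -> edom g u -> edom g v ->
  edom g ((1 - t) *: u + t *: v) /\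
  fine (g ((1 - t) *: u + t *: v)) <= (1 - t) * fine (g u) + t * fine (g v).
Proof.
move=> t01 gu gv; have := g_convex v u t01.
rewrite (proper_fineK g_proper gu) (proper_fineK g_proper gv) -!EFinM -EFinD.
rewrite addrC [t * _ + _]addrC => h.
have d : edom g ((1 - t) *: u + t *: v) by exact: le_lt_trans h (ltry _).
by split=> //; rewrite -lee_fin -(proper_fineK g_proper d).
Qed.

Lemma prox_spec (lam : R) u : 0 < lam ->
  argmin (fun v => g v + ((2 * lam)^-1 * `|v - u| ^+ 2)%:E)%E (prox lam g u).
Proof.
move=> lam0; have [c [a minor]] := g_affine_minorant.
exact: (prox_argmin ip_norm g_proper g_convex g_lsc u lam0 minor).
Qed.

Lemma prox_dom (lam : R) u : 0 < lam -> edom g (prox lam g u).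
Proof.
move=> lam0; have [v gv] := g_proper.2; have := prox_spec u lam0 v.
rewrite (proper_fineK g_proper gv) -EFinD => h.
have := le_lt_trans h (ltry _); rewrite /edom /=.
by case: (g (prox lam g u)) => [r||] //=; rewrite !ltry.
Qed.

Lemma prox_ineq (lam : R) u v : 0 < lam -> edom g v ->
  fine (g (prox lam g u)) + lam^-1 * ip (u - prox lam g u) (v - prox lam g u)
    <= fine (g v).
Proof.
move=> lam0 gv; apply: (prox_first_order ip_norm g_convex lam0 (prox_spec u lam0)).
  exact/(proper_fineK g_proper)/prox_dom.
exact: (proper_fineK g_proper).
Qed.

Variables (S dS : R -> R).
Hypothesis S_range : forall r : R, 0 <= r -> 0 <= S r < 1.
Hypothesis S_der : derivative_within `[0, +oo[ S dS.
Hypothesis S_mono : {in `[0, +oo[ &, {homo S : r t / r <= t}}.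
Hypothesis S_conc : convex_function (`[0, +oo[ : set R) (fun r => - S r).
Hypothesis S_riccati : forall r : R, 0 <= r -> 0 < 2 * dS r + S r ^+ 2 <= 1.
Hypothesis S0 : S 0 = 0.

Local Notation th := (theta S s mu).
Local Notation tau k := (Num.sqrt s / th k).
Local Notation lam k := (Num.sqrt s * th k).
Local Notation Phi := (fun v => (f v + fine (g v))).

Lemma s_gt0 : 0 < s. Proof. by case/andP: s_range. Qed.

Lemma th_gt0 k : 0 < th k.
Proof. exact: (theta_gt0 S_range s_gt0 mu0 smu_lt1). Qed.

Lemma tau01 k : 0 < tau k <= 1.
Proof.
rewrite divr_gt0 ?th_gt0 ?sqrtr_gt0 ?s_gt0//= ler_pdivrMr ?th_gt0// mul1r.
exact: (sqrts_le_theta S_range s_gt0 mu0 smu_lt1).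
Qed.

Lemma lam_gt0 k : 0 < lam k.
Proof. by rewrite mulr_gt0 ?th_gt0 ?sqrtr_gt0 ?s_gt0. Qed.

Lemma tau_lam k : tau k * lam k = s.
Proof.
rewrite mulrACA mulVf ?gt_eqF ?th_gt0// mulr1 -expr2 sqr_sqrtr//.
exact/ltW/s_gt0.
Qed.

Lemma mu_lamE k : mu * lam k = Num.sqrt (s * mu) * level S s mu k.
Proof. by rewrite mulrA [mu * _]mulrC (sqrts_mu_theta S s_gt0 mu0). Qed.

Lemma mu_lam_le1 k : mu * lam k <= 1.
Proof.
by rewrite mu_lamE -subr_ge0 ltW// (contraction_gt0 S_range s_gt0 mu0 smu_lt1).
Qed.

(** The coefficient [beta] is the one for which the extrapolated point solves
    this implicit equation. *)
Lemma extrapolation_anchor (x z : nat -> H) k :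
  x k = (1 - tau k) *: x k.-1 + tau k *: z k ->
  let y := extrapolation S s mu x k in
  y = (1 - tau k.+1) *: x k +
      tau k.+1 *: (z k - (mu * lam k.+1) *: (z k - y)).
Proof.
move=> xE /=; rewrite /extrapolation xE.
have sE : s = Num.sqrt s ^+ 2 by rewrite sqr_sqrtr// ltW// s_gt0.
have := smu_lt1; rewrite /beta [X in 1 - X * mu]sE [X in X * mu < 1]sE.
move: (th_gt0 k) (th_gt0 k.+1) (Num.sqrt s) => a0 b0 u umu.
apply: (ip_ext ip_norm) => v; rewrite !(ipE ip).
move: (ip _ _) (ip _ _) => p q; move: a0 b0.
move: (th k) (th k.+1) => a b a0 b0.
field; rewrite !gt_eqF//=; lra.
Qed.

Section iterates.
Variables x z : nat -> H.
Hypothesis scheme : one_sequence_scheme gradf g S s mu x z \/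
  two_sequence_scheme gradf g S s mu x z.

(** For the one-sequence scheme this is the definition of [z] solved for [x];
    at [k = 1] it holds because [x 0 = x 1 = z 1]. *)
Lemma iterate_conv k : (1 <= k)%N -> x k = (1 - tau k) *: x k.-1 + tau k *: z k.
Proof.
have [x01 xz1 _] : scheme_init g x z by case: scheme => [[]|[]].
case: k => // -[_|k _] /=.
  by rewrite x01 -xz1 -scalerDl subrK scale1r.
case: scheme => [[_ /(_ k.+1 isT)[_ ->]]|[_ /(_ k.+1 isT)[_ ->]]] //.
apply: (ip_ext ip_norm) => v; rewrite !(ipE ip); field.
by rewrite !gt_eqF ?th_gt0// sqrtr_gt0 s_gt0.
Qed.

Lemma iterate_dom k : (1 <= k)%N -> edom g (x k).
Proof.
have [_ _ x1] : scheme_init g x z by case: scheme => [[]|[]].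
elim: k => // -[//|k] IH _.
case: scheme => [[_ /(_ k.+1 isT)[-> _]]|[_ /(_ k.+1 isT)[zE xE]]].
  exact/prox_dom/s_gt0.
rewrite xE; apply: (g_conv_real _ (IH isT) _).1.
  by have /andP[/ltW -> ->] := tau01 k.+2.
by rewrite zE; exact/prox_dom/lam_gt0.
Qed.

Lemma iterate_decrease k : (1 <= k)%N ->
  step_decrease mu (tau k.+1) (lam k.+1) (z k) (z k.+1) xstar
    (Phi (x k)) (Phi (x k.+1)) (Phi xstar).
Proof.
move=> k1; have yE := extrapolation_anchor (iterate_conv k1).
have x'E := @iterate_conv k.+1 isT.
have t01 := tau01 k.+1; have t01' : 0 <= tau k.+1 <= 1.
  by have /andP[/ltW -> ->] := t01.
have xk := iterate_dom k1.
case: scheme => [[_ /(_ k k1)[xE _]]|[_ /(_ k k1)[zE _]]].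
  have [gv gv_le] := g_conv_real t01' xk xstar_dom.
  apply: (one_sequence_step ip_norm f_sconvex f_smooth mu0 t01 (lam_gt0 _)
    (tau_lam _) (mu_lam_le1 _) yE x'E gv_le).
  rewrite xE; exact: (prox_ineq _ s_gt0 gv).
have gz : edom g (z k.+1) by rewrite zE; exact/prox_dom/lam_gt0.
have [_ gx_le] := g_conv_real t01' xk gz.
apply: (two_sequence_step ip_norm f_sconvex f_smooth mu0 t01 (lam_gt0 _)
    (tau_lam _) (mu_lam_le1 _) yE x'E (gz' := fine (g (z k.+1)))).
  by rewrite {1}x'E.
rewrite {1 2 3}zE; exact: (prox_ineq _ (lam_gt0 _) xstar_dom).
Qed.

Definition energy k :=
  th k ^+ 2 * (Phi (x k) - Phi xstar) + 2^-1 * `|z k - xstar| ^+ 2.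

Lemma gap_value_ge0 k : (1 <= k)%N -> 0 <= Phi (x k) - Phi xstar.
Proof.
move=> k1; rewrite subr_ge0 -lee_fin !EFinD.
rewrite -(proper_fineK g_proper xstar_dom) -(proper_fineK g_proper (iterate_dom k1)).
exact: xstar_min.
Qed.

Lemma energy_contraction k : (1 <= k)%N ->
  energy k.+1 <= (1 - Num.sqrt (s * mu) * level S s mu k.+1) * energy k.
Proof.
move=> k1; have := iterate_decrease k1; have gap0 := gap_value_ge0 k1.
have := theta_growth S_range S_der S_mono S_conc S_riccati s_gt0 mu0 smu_lt1 k1.
move=> /(ler_wpM2r gap0); rewrite /step_decrease /energy -mu_lamE.
have -> : Num.sqrt s * mu * th k.+1 = mu * lam k.+1 by ring.
have th2 : 0 < th k.+1 ^+ 2 by rewrite exprn_gt0// th_gt0.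
have -> : tau k.+1 / (2 * lam k.+1) = (th k.+1 ^+ 2)^-1 / 2.
  by field; rewrite !gt_eqF ?th_gt0// sqrtr_gt0 s_gt0.
have rescale (a b q D D' n n' m : R) : 0 < a ->
    (1 - q) * a * D <= (1 - m) * b * D ->
    D' + a^-1 / 2 * n' <= (1 - q) * D + a^-1 / 2 * (1 - m) * n ->
    a * D' + 2^-1 * n' <= (1 - m) * (b * D + 2^-1 * n).
  move=> a0 growth /(ler_wpM2l (ltW a0)).
  have -> : a * (D' + a^-1 / 2 * n') = a * D' + 2^-1 * n'.
    by field; rewrite gt_eqF.
  have -> : a * ((1 - q) * D + a^-1 / 2 * (1 - m) * n) =
      (1 - q) * a * D + 2^-1 * (1 - m) * n by field; rewrite gt_eqF.
  by lra.
by move=> growth; exact: rescale.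
Qed.

Lemma energy_le_decay k : (1 <= k)%N ->
  energy k <= decay S s mu k *
    (energy 1 / (1 - Num.sqrt (s * mu) * level S s mu 1)).
Proof.
have c0 j := contraction_gt0 S_range s_gt0 mu0 smu_lt1 j.
elim: k => // -[_ _|k IH _].
  by rewrite decayS /decay big_nil mul1r mulrC divfK// gt_eqF.
apply: le_trans (energy_contraction (ltn0Sn k)) _.
rewrite decayS mulrAC mulrC ler_wpM2r ?(ltW (c0 _))//.
exact: IH.
Qed.

Lemma energy1E : energy1 S s mu (fun v => (f v)%:E + g v)%E xstar (x 1%N) (z 1%N)
  = (energy 1 / (1 - Num.sqrt (s * mu) * level S s mu 1))%:E.
Proof.
rewrite /energy1 (proper_fineK g_proper xstar_dom).
rewrite (proper_fineK g_proper (iterate_dom (leqnn 1))).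
rewrite -!EFinD -(sqrts_mu_theta S s_gt0 mu0) /energy.
congr (_%:E); field.
rewrite (sqrts_mu_theta S s_gt0 mu0) gt_eqF//.
exact: (contraction_gt0 S_range s_gt0 mu0 smu_lt1).
Qed.

Lemma energy_ge0 k : (1 <= k)%N -> 0 <= energy k.
Proof.
move=> k1; rewrite addr_ge0// mulr_ge0 ?sqr_ge0//; exact: gap_value_ge0.
Qed.

Lemma initial_energy_ge0 :
  0 <= energy 1 / (1 - Num.sqrt (s * mu) * level S s mu 1).
Proof.
by rewrite divr_ge0 ?energy_ge0// ltW// (contraction_gt0 S_range s_gt0 mu0 smu_lt1).
Qed.

(** The energy at step 1 carries the factor [decay 1], which is why the
    starting constant is divided by [1 - h level 1]. *)
Lemma gap_value_le (xi : R) k : 0 < dS 0 -> (1 < k)%N ->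
  (\int[lebesgue_measure]_(r in `[0%R, +oo[) (1 - S r)%:E = xi%:E)%E ->
  Phi (x k) - Phi xstar <=
    energy 1 / (1 - Num.sqrt (s * mu) * level S s mu 1) * s^-1 *
    Num.min (Csmu S s mu * (k%:R - 1) ^+ 2)^-1
      (expR (Num.sqrt (s * mu) + xi) * (1 - Num.sqrt (s * mu)) ^+ k).
Proof.
move=> kappa0 k1 hxi.
have rate := rate_le_min S_range S_der S_mono S_conc s_gt0 mu0 smu_lt1 S0
  kappa0 k1 hxi.
rewrite -mulrA; apply: le_trans (ler_wpM2l initial_energy_ge0 rate).
have th2 : 0 < th k ^+ 2 by rewrite exprn_gt0// th_gt0.
rewrite mulrA ler_pdivlMr// [leRHS]mulrC; apply: le_trans (energy_le_decay (ltnW k1)).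
by rewrite /energy mulrC lerDl mulr_ge0 ?sqr_ge0.
Qed.

End iterates.
End convergence.

(** * Asymptotic form of the rate *)

Section rates.
Context {R : realType}.

(** The constant [4] comes from [k <= 2 (k - 1)] for [k >= 2]. *)
Lemma rate_min_le (C B q : R) (k : nat) : 0 < C -> 0 <= B -> 0 <= q -> (1 < k)%N ->
  Num.min (C * (k%:R - 1) ^+ 2)^-1 (B * q ^+ k) <=
  Num.max (4 / C) B * Num.min (k%:R ^- 2) (q ^+ k).
Proof.
move=> C0 B0 q0 k1.
have M0 : 0 <= Num.max (4 / C) B by rewrite le_max B0 orbT.
have k2 : 2 <= k%:R :> R by rewrite ler_nat.
rewrite minr_pMr// le_min !ge_min; apply/andP; split; apply/orP; [left|right].
  apply: (@le_trans _ _ (4 / C * k%:R ^- 2)); last first.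
    by rewrite ler_wpM2r ?le_max ?lexx// invr_ge0 exprn_ge0.
  have K0 : 0 < k%:R :> R by lra.
  rewrite -[4 in X in _ <= X]invrK -!invfM.
  rewrite lef_pV2 ?posrE ?mulr_gt0 ?invr_gt0 ?exprn_gt0 ?subr_gt0 ?ltr1n//.
  by rewrite mulrAC mulrC ler_pM2l//; nra.
by rewrite ler_wpM2r ?exprn_ge0// le_max lexx orbT.
Qed.

Lemma bigO_of_eventual_le (u v : nat -> R) (K : R) :
  (forall k, (1 < k)%N -> 0 <= u k <= K * v k) -> (forall k, 0 <= v k) ->
  (u : nat -> R^o) =O_\oo (v : nat -> R^o).
Proof.
move=> uv v0; apply/eqOP; near=> M; exists 2%N => // k /= k1.
have /andP[u0 uK] := uv k k1.
rewrite !ger0_norm//; apply: le_trans uK _.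
by rewrite ler_wpM2r//; near: M; exact: nbhs_pinfty_ge.
Unshelve. all: by end_near. Qed.

End rates.

(** * Parameters, inertial coefficient and convergence rates *)

Theorem theorem3p3
  (R : realType) (H : completeNormedModType R) (ip : {dot H for (@idfun R)})
  (hip : induces_norm ip)
  (f : H -> R) (gradf : H -> H) (g : H -> \bar R) (mu L s : R)
  (hmu : 0 < mu) (hL : 0 < L) (hmuL : mu < L)
  (hgrad : is_gradient ip f gradf) (hgradc : continuous gradf)
  (hsc : strongly_convex ip mu f gradf)
  (hLip : L.-lipschitz gradf)
  (hgp : proper_fun g) (hglsc : lower_semicontinuous g) (hgconv : econvex g)
  (hs : 0 < s <= L^-1)
  (xstar : H)
  (hxstar : argmin (fun v => (f v)%:E + g v)%E xstar)
  (S dS : R -> R) (kappa xi : R)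
  (hSrange : forall r : R, 0 <= r -> 0 <= S r < 1)
  (hSder : derivative_within `[0, +oo[ S dS)
  (hdScont : {within `[0, +oo[, continuous dS})
  (hSmono : {in `[0, +oo[ &, {homo S : r t / r <= t}})
  (hSconc : convex_function (`[0, +oo[ : set R) (fun r => - S r))
  (hS0 : S 0 = 0)
  (hSineq : forall r : R, 0 <= r -> 0 < 2 * dS r + S r ^+ 2 <= 1)
  (hdS0 : dS 0 = kappa) (hkappa : 0 < kappa <= 2^-1)
  (hSlim : S r @[r --> +oo] --> (1 : R))
  (hdSlim : dS r @[r --> +oo] --> (0 : R))
  (hxi : (\int[lebesgue_measure]_(r in `[0%R, +oo[) (1 - S r)%:E = xi%:E)%E) :
  let Phi : H -> \bar R := fun v => ((f v)%:E + g v)%E in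
  let h : R := Num.sqrt (s * mu) in
  [/\ (* (i) *)
      [/\ forall k : nat, (1 <= k)%N ->
            [/\ Num.sqrt s <= theta S s mu k,
                mu * theta S s mu k ^+ 2 <= 1 &
                (1 - Num.sqrt s / theta S s mu k.+1) * theta S s mu k.+1 ^+ 2
                <= (1 - Num.sqrt s * mu * theta S s mu k.+1)
                   * theta S s mu k ^+ 2],
          forall k : nat, (1 <= k)%N -> theta S s mu k <= theta S s mu k.+1 &
          theta S s mu k @[k --> \oo] --> (Num.sqrt mu)^-1],
      (* (ii) *)
      [/\ forall k : nat, (1 <= k)%N ->
            beta S s m k @[m --> 0^'+] -->
              kappa * (k%:R - 1) / (1 + kappa * k%:R),
          forall m : R, 0 < m ->
            beta S s m k @[k --> \oo] -->
              (1 - Num.sqrt (s * m)) / (1 + Num.sqrt (s * m)) &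
          forall gamma : R, 3 <= gamma -> kappa = (gamma - 1)^-1 ->
            forall k : nat, (1 <= k)%N ->
              beta S s m k @[m --> 0^'+] -->
                (k%:R - 1) / (k%:R + gamma - 1)] &
      (* (iii) *)
      forall x z : nat -> H,
        one_sequence_scheme gradf g S s mu x z \/
        two_sequence_scheme gradf g S s mu x z ->
        (forall k : nat, (1 < k)%N ->
           (Phi (x k) - Phi xstar <=
            energy1 S s mu Phi xstar (x 1%N) (z 1%N) * (s^-1)%:E *
            (Num.min (Csmu S s mu * (k%:R - 1) ^+ 2)^-1
                     (expR (h + xi) * (1 - h) ^+ k))%:E)%E) /\
        (fun k => fine (Phi (x k) - Phi xstar)%E : R^o) =O_\oo
        (fun k => Num.min (k%:R ^- 2) ((1 - h) ^+ k) : R^o)].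
Proof.
move=> Phi h; have /andP[s0 sL] := hs.
have smu1 : s * mu < 1 := smu_lt1 hmu hL hmuL hs.
have dS0 : 0 < dS 0 by rewrite hdS0; case/andP: hkappa.
split.
- split.
  + move=> k k1; split.
    * exact: (sqrts_le_theta hSrange s0 hmu smu1).
    * exact: (mu_theta_sqr_le1 hSrange s0 hmu smu1).
    * exact: (theta_growth hSrange hSder hSmono hSconc hSineq s0 hmu smu1 k1).
  + move=> k; exact: (theta_nondecreasing hSmono s0 hmu smu1).
  + exact: theta_cvg.
- split.
  + by move=> k k1; rewrite -hdS0; exact: (beta_cvg_mu0 s0 hSder hS0 dS0 k1).
  + by move=> m m0; exact: beta_cvg_oo.
  + move=> gamma gamma3 kappaE k k1.
    have -> : (k%:R - 1) / (k%:R + gamma - 1) =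
        kappa * (k%:R - 1) / (1 + kappa * k%:R).
      rewrite kappaE; field; have : 0 <= k%:R :> R by [].
      by move=> k0; rewrite !gt_eqF//; lra.
    by rewrite -hdS0; exact: (beta_cvg_mu0 s0 hSder hS0 dS0 k1).
- move=> x z scheme.
  have xstar_fin := xstar_dom hgp hxstar.
  have x_fin k : (1 <= k)%N -> edom g (x k).
    exact: (iterate_dom hip hmu hL hmuL hsc hLip hgp hglsc hgconv hs hxstar
      hSrange scheme).
  have PhiB k : (1 <= k)%N -> (Phi (x k) - Phi xstar =
      (f (x k) + fine (g (x k)) - (f xstar + fine (g xstar)))%:E)%E.
    move=> k1; rewrite /Phi (proper_fineK hgp xstar_fin).
    by rewrite (proper_fineK hgp (x_fin k k1)) -!EFinD.
  have gap0 k : (1 <= k)%N ->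
      0 <= f (x k) + fine (g (x k)) - (f xstar + fine (g xstar)).
    exact: (gap_value_ge0 hip hmu hL hmuL hsc hLip hgp hglsc hgconv hs hxstar
      hSrange scheme).
  have gap_le k (k1 : (1 < k)%N) := gap_value_le hip hmu hL hmuL hsc hLip hgp hglsc
    hgconv hs hxstar hSrange hSder hSmono hSconc hSineq hS0 scheme dS0 k1 hxi.
  split.
    move=> k k1; rewrite PhiB 1?ltnW//.
    rewrite (energy1E hip hmu hL hmuL hsc hLip hgp hglsc hgconv hs hxstar
      hSrange scheme).
    by rewrite -!EFinM lee_fin; exact: gap_le.
  have h1 : 0 <= 1 - h by rewrite subr_ge0 ltW// (step_lt1 smu1).
  have C0 := Csmu_gt0 hSder hSmono smu1 hS0 dS0.
  set E1 := energy f g mu s xstar S x z 1 / _ * _ in gap_le.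
  have E0 : 0 <= E1.
    apply: mulr_ge0; last by rewrite invr_ge0 ltW.
    exact: (initial_energy_ge0 hip hmu hL hmuL hsc hLip hgp hglsc hgconv hs hxstar
      hSrange scheme).
  apply: (bigO_of_eventual_le
    (K := E1 * Num.max (4 / Csmu S s mu) (expR (h + xi)))).
    move=> k k1; rewrite PhiB 1?ltnW//= gap0 1?ltnW//=.
    apply: le_trans (gap_le k k1) _; rewrite -mulrA ler_wpM2l//.
    by apply: rate_min_le => //; exact: expR_ge0.
  by move=> k; rewrite le_min invr_ge0 !exprn_ge0.
Qed.
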